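(* There exists an absolute constant $C>1$ such that the following holds. Let $p$ be a prime, $G=\mathrm{SL}_2(\mathbb{F}_p)$, and let $A$ be a symmetric generating set of $G$ with $N>C$ elements. Let $d=\log_{3/2}8$ (so $d\approx 5.13$). Then the Cayley graph of $G$ relative to $A$ has diameter at most $$C\left(\frac{\log|G|}{\log(N/C)}\right)^{d}.$$
   Context: $A$ is symmetric if $A=A^{-1}$. The Cayley graph of $G$ relative to $A$ has vertex set $G$, with $g$ and $ga$ joined by an edge for every $g\in G$, $a\in A$; its diameter is the least $m$ such that every element of $G$ is a product of at most $m$ elements of $A$. *)

(* Defs.v *)
From HB Require Import structures.
From mathcomp Require Import all_boot all_order all_algebra all_fingroup.
From mathcomp Require Import reals exp.

Set Implicit Arguments.
Unset Strict Implicit.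
Unset Printing Implicit Defensive.

Import Order.TTheory GRing.Theory Num.Theory.

Local Open Scope group_scope.

(* As for 'GL_n[R], the matrices have size n.-1.+1, which is n for n > 0. *)
Definition SLgroup (n : nat) (R : finComUnitRingType) : {set {'GL_n[R]}} :=
  [set u | (\det (GLval u) == 1)%R].

Lemma SLgroup_is_group n (R : finComUnitRingType) : group_set (SLgroup n R).
Proof.
apply/group_setP; split=> [|u v]; first by rewrite inE GL_1E det1.
by rewrite !inE GL_ME det_mulmx => /eqP-> /eqP->; rewrite mulr1.
Qed.

Canonical SLgroup_group n (R : finComUnitRingType) := Group (SLgroup_is_group n R).

Notation "''SL_' n ( p )" := (SLgroup n 'F_p)
  (at level 8, n at level 2, p at level 10, format "''SL_' n ( p )")
  : group_scope.
Notation "''SL_' n ( p )" := (SLgroup_group n 'F_p) : Group_scope.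

Section Cayley.
Variable gT : finGroupType.
Implicit Types (G A : {set gT}) (g h : gT) (m : nat).

(* The inverse here is pointwise, {a^-1 : a in A}. *)
Definition symmetric_set A : Prop := A = A^-1.

Definition cayley_edge A : rel gT := fun g h => [exists a in A, h == g * a].

(* A ^+ k is the set of products of exactly k elements of A; A ^+ 0 = {1}. *)
Definition word_ball A m : {set gT} := \bigcup_(k < m.+1) A ^+ k.

Definition is_cayley_diameter G A m : Prop :=
  G \subset word_ball A m /\
  forall k, G \subset word_ball A k -> m <= k.

(* word_ball A m is the ball of radius m about 1 for the graph distance. *)
Lemma mem_expsg_path A k h :
  reflect (exists2 s : seq gT, path (cayley_edge A) 1 s & size s = k /\ last 1 s = h)
          (h \in A ^+ k).
Proof.
elim: k h => [|k IHk] h.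
  rewrite expg0; apply: (iffP set1P) => [->|]; first by exists [::].
  by case=> s _ [/size0nil-> /= <-].
rewrite expgSr; apply: (iffP idP) => [/mulsgP[g a /IHk[s sP [<- <-]] Aa ->] | [s]].
  exists (rcons s (last 1 s * a)); last by rewrite size_rcons last_rcons.
  by rewrite rcons_path sP; apply/existsP; exists a; rewrite Aa eqxx.
case/lastP: s => [_ []//|s x]; rewrite rcons_path size_rcons last_rcons.
case/andP=> sP /existsP[a /andP[Aa /eqP->]] [[sk] <-].
by apply: mem_mulg => //; apply/IHk; exists s => //; case: sk.
Qed.

Lemma mem_word_ball_path A m h :
  (exists2 s : seq gT, path (cayley_edge A) 1 s & size s <= m /\ last 1 s = h)
  <-> h \in word_ball A m.
Proof.
split=> [[s sP [sm sh]] | /bigcupP[[k km] _ /mem_expsg_path[s sP [sk sh]]]].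
  by apply/bigcupP; exists (Ordinal (sm : size s < m.+1)) => //;
     apply/mem_expsg_path; exists s.
by exists s; rewrite // sk.
Qed.

End Cayley.

(* Main.v *)
(** Let B_m be the ball of radius m and N = |B_m|. If some regular h in B_(2m+2)
    has a centraliser meeting B_2m in O(1) elements, then B_(4m+2) contains a set S
    of >> N conjugates of h. A generic triple (u, v, w) of elements of S is
    determined up to two choices by the pair (u^-1 v, u^-1 w), because u then lies
    on the intersection of a line with the quadric det = 1; hence
    N^3 << |B_(8m+6)|^2. Otherwise the centraliser of every conjugate of one
    regular element meets B_2m nontrivially, and |B_2m| >> |F|^2. Each step of the
    first kind multiplies the radius by 8 and log N by 3/2, whence the exponent
    log_(3/2) 8, and only O(1) further steps are needed once N >> |F|^2: applied
    with tori required to contain about |B| / |F|^2 elements, the dichotomy leads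
    to N >> |F|^(8/3); such a ball has so many unipotent elements x and diagonal
    entries l that the sums x + l^2 y fill half of a unipotent subgroup; three of
    these give a positive proportion of the group, and a generating set of
    positive proportion covers the group in O(1) steps. *)

Require Import Defs.
From mathcomp Require Import all_boot all_order all_algebra all_fingroup.
From mathcomp Require Import reals exp.
From mathcomp Require Import ring lra zify.

Set Implicit Arguments.
Unset Strict Implicit.
Unset Printing Implicit Defensive.

Import Order.TTheory GRing.Theory Num.Theory.

Local Open Scope ring_scope.

(** * Entries, traces and commutators *)

(** Triples are used because the dimensions then match: a conjugacy class is a surface, so triples
    have 6 parameters, as many as a pair of quotients in the threefold G, while single quotients of
    pairs (4 against 3) lose one. The obstacle is degeneracy. The fibre count needs [delta u v]
    nonzero, which fails for u and v fixing a common line, and S may even lie in one Borel subgroup.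
    Replacing the second member of a pair by its conjugate under a generator that moves the line
    cures this, at the price of 2 in the radius. Constants do not accumulate: with growth N^3 <= K
    M^2, logarithms measured from ln K multiply exactly by 3/2, which is why the bound contains log
    (N/C). Small p, in particular 2 and 3, are settled by choosing C above p^3. *)

Definition GL2 (F : finFieldType) : finGroupType := {'GL_2[F]}.
Definition SL2 (F : finFieldType) : {group GL2 F} := SLgroup_group 2 F.

Section Entries.
Variable F : finFieldType.
Local Notation SL := (SL2 F).
Implicit Types u v w : GL2 F.

Definition ea u : F := GLval u 0 0.
Definition eb u : F := GLval u 0 1.
Definition ec u : F := GLval u 1 0.
Definition ed u : F := GLval u 1 1.
Definition tr u : F := ea u + ed u.

Lemma det_mx2 (M : 'M[F]_2) : \det M = M 0 0 * M 1 1 - M 0 1 * M 1 0.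
Proof.
rewrite (expand_det_row _ 0) !big_ord_recl big_ord0 addr0 /cofactor !det_mx11 !mxE /=.
rewrite expr0 expr1 mul1r mulN1r mulrN.
by congr (M _ _ * M _ _ - M _ _ * M _ _); apply: val_inj.
Qed.

Lemma ent_eq u v : ea u = ea v -> eb u = eb v -> ec u = ec v -> ed u = ed v -> u = v.
Proof.
move=> h1 h2 h3 h4; apply: val_inj; apply/matrixP => i j.
have o2 (k : 'I_2) : k = 0 \/ k = 1.
  case: k => [[|[|k]]] //= hk; [left|right]; exact: val_inj.
by case: (o2 i) => ->; case: (o2 j) => ->.
Qed.

Lemma GLval_mul2 u v i j :
  GLval (u * v)%g i j = GLval u i 0 * GLval v 0 j + GLval u i 1 * GLval v 1 j.
Proof.
rewrite GL_ME mxE !big_ord_recl big_ord0 addr0.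
by congr (_ + GLval u i _ * GLval v _ j); apply: val_inj.
Qed.

Lemma eaM u v : ea (u * v)%g = ea u * ea v + eb u * ec v.
Proof. by exact: GLval_mul2. Qed.

Lemma ebM u v : eb (u * v)%g = ea u * eb v + eb u * ed v.
Proof. by exact: GLval_mul2. Qed.

Lemma ecM u v : ec (u * v)%g = ec u * ea v + ed u * ec v.
Proof. by exact: GLval_mul2. Qed.

Lemma edM u v : ed (u * v)%g = ec u * eb v + ed u * ed v.
Proof. by exact: GLval_mul2. Qed.

Definition entM := (eaM, ebM, ecM, edM).

Lemma ent1 : (ea 1%g = 1) * (eb 1%g = 0) * (ec 1%g = 0) * (ed 1%g = 1).
Proof. by rewrite /ea /eb /ec /ed GL_1E !mxE. Qed.

Lemma SLP u : (u \in SL) = (ea u * ed u - eb u * ec u == 1).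
Proof. by rewrite inE det_mx2. Qed.

Lemma SLE u : u \in SL -> ea u * ed u - eb u * ec u = 1.
Proof. by rewrite SLP => /eqP. Qed.

Lemma SL_ex (a b c d : F) : a * d - b * c = 1 ->
  exists u, [/\ u \in SL, ea u = a, eb u = b, ec u = c & ed u = d].
Proof.
move=> h.
pose M : 'M[F]_2 := \matrix_(i < 2, j < 2) (if i == 0 then (if j == 0 then a else b) else (if j == 0 then c else d)).
have dM : \det M = 1 by rewrite det_mx2 !mxE /=.
have uM : M \is a GRing.unit by rewrite unitmxE dM unitr1.
by exists (FinRing.unit 'M[F]_2 uM : GL2 F); rewrite SLP /ea /eb /ec /ed /= !mxE /= h.
Qed.

Lemma entV u : u \in SL ->
  (ea u^-1%g = ed u) * (eb u^-1%g = - eb u) * (ec u^-1%g = - ec u) * (ed u^-1%g = ea u).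
Proof.
move=> uS; have h := SLE uS.
have h' : ed u * ea u - (- eb u) * (- ec u) = 1 by rewrite -h; ring.
have [v [_ va vb vc vd]] := SL_ex h'.
suff -> : u^-1%g = v by rewrite va vb vc vd.
apply: (mulgI u); rewrite mulgV; apply: ent_eq; rewrite !entM !ent1 ?va ?vb ?vc ?vd -?h; ring.
Qed.

Lemma trC u v : tr (u * v)%g = tr (v * u)%g.
Proof. by rewrite /tr !entM; ring. Qed.

Lemma trJ u v : tr (u ^ v)%g = tr u.
Proof. by rewrite conjgE trC -mulgA mulgV mulg1. Qed.

Lemma trV u : u \in SL -> tr u^-1%g = tr u.
Proof. by move=> uS; rewrite /tr !entV // addrC. Qed.

(* Trace 0 is excluded too: [plane_points] fails for it, since a plane through
   the origin may then meet the conjugacy class in a conic. *)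
Definition reg u := (tr u != 0) && (tr u ^+ 2 != 4).

(** The first column leaves one free entry: b if c = 0, where d = 1/a, and d otherwise, where det =
    1 gives b. *)
Lemma card_SL_le : (#|SL| <= #|F| ^ 3)%N.
Proof.
pose f u := (ea u, ec u, if ec u == 0 then eb u else ed u).
have -> : (#|F| ^ 3)%N = #|{: F * F * F}| by rewrite !card_prod !expnS expn0 muln1 mulnA.
rewrite -(card_in_imset (f := f)); first exact: max_card.
move=> u v uS vS; rewrite /f => -[ha hc]; rewrite hc; have hu := SLE uS; have hv := SLE vS.
case: eqP => c0 h; last first.
  apply: ent_eq => //; apply: (mulIf (x := ec v)); first by apply/eqP.
  have -> : eb u * ec v = ea u * ed u - 1 by rewrite -hu hc; ring.
  by rewrite ha h -hv; ring.
apply: ent_eq => //.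
rewrite hc c0 mulr0 subr0 in hu; rewrite c0 mulr0 subr0 in hv.
have a0 : ea v != 0 by apply/eqP=> e; move: hv; rewrite e mul0r => /eqP; rewrite eq_sym oner_eq0.
by apply: (mulfI a0); rewrite hv -ha.
Qed.

Lemma card_SL_ge : (#|F| ^ 2 * #|F|.-1 <= #|SL|)%N.
Proof.
pose f u := (ea u, ed u, ec u).
pose D : {set F * F * F} := setX setT [set~ 0].
have -> : (#|F| ^ 2 * #|F|.-1)%N = #|D|.
  by rewrite cardsX cardsT cardsC1 card_prod mulnn.
apply: leq_trans (leq_imset_card f _); apply: subset_leq_card.
apply/subsetP => -[[a d] c]; rewrite !inE /= => c0.
have h : a * d - ((a * d - 1) / c) * c = 1 by rewrite divfK //; ring.
by have [u [uS <- _ <- <-]] := SL_ex h; apply/imsetP; exists u.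
Qed.

End Entries.

Section LinearCombination.
Variable F : comRingType.
Implicit Types a b k c d : F.

(** Certificates of ideal membership: once the cofactors k are given, deducing an equation from
    hypotheses c = d is an identity for [ring]. *)
Lemma lincomb1 k c d a b : c = d -> a - b = k * (c - d) :> F -> a = b.
Proof. by move=> ->; rewrite subrr mulr0 => /subr0_eq. Qed.

Lemma lincomb2 k c d k' c' d' a b : c = d -> c' = d' ->
  a - b = k * (c - d) + k' * (c' - d') :> F -> a = b.
Proof. by move=> -> ->; rewrite !subrr !mulr0 addr0 => /subr0_eq. Qed.

Lemma lincomb3 k c d k' c' d' k2 c2 d2 a b : c = d -> c' = d' -> c2 = d2 ->
  a - b = k * (c - d) + k' * (c' - d') + k2 * (c2 - d2) :> F -> a = b.
Proof. by move=> -> -> ->; rewrite !subrr !mulr0 !addr0 => /subr0_eq. Qed.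

Lemma lincomb4 k c d k' c' d' k2 c2 d2 k3 c3 d3 a b : c = d -> c' = d' -> c2 = d2 -> c3 = d3 ->
  a - b = k * (c - d) + k' * (c' - d') + k2 * (c2 - d2) + k3 * (c3 - d3) :> F -> a = b.
Proof. by move=> -> -> -> ->; rewrite !subrr !mulr0 !addr0 => /subr0_eq. Qed.

End LinearCombination.

Section Vec.
Variable F : fieldType.
Implicit Types p q r : F * F * F.

Definition dot p q : F := p.1.1 * q.1.1 + p.1.2 * q.1.2 + p.2 * q.2.
Definition cross p q : F * F * F :=
  (p.1.2 * q.2 - p.2 * q.1.2, p.2 * q.1.1 - p.1.1 * q.2, p.1.1 * q.1.2 - p.1.2 * q.1.1).
Definition scal (k : F) p : F * F * F := (k * p.1.1, k * p.1.2, k * p.2).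
Definition qf p : F := p.1.1 ^+ 2 + p.1.2 * p.2.

Lemma v3_eq p q : p.1.1 = q.1.1 -> p.1.2 = q.1.2 -> p.2 = q.2 -> p = q.
Proof. by case: p q => [[x y] z] [[x' y'] z'] /= -> -> ->. Qed.

Lemma v3_eq0 p : (p == (0, 0, 0)) = [&& p.1.1 == 0, p.1.2 == 0 & p.2 == 0].
Proof. by case: p => [[x y] z] /=; rewrite !xpair_eqE andbA. Qed.


Lemma crossP p q : cross p q = (0, 0, 0) <->
  [/\ p.1.2 * q.2 = p.2 * q.1.2, p.2 * q.1.1 = p.1.1 * q.2 & p.1.1 * q.1.2 = p.1.2 * q.1.1].
Proof.
rewrite /cross; split=> [[h1 h2 h3]|[-> -> ->]]; last by rewrite !subrr.
by split; apply: subr0_eq.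
Qed.

Lemma crossC0 p q : cross p q = (0, 0, 0) -> cross q p = (0, 0, 0).
Proof. by move=> /crossP[h1 h2 h3]; apply/crossP; split; rewrite mulrC -?h1 -?h2 -?h3 mulrC. Qed.

Lemma crossxx p : cross p p = (0, 0, 0).
Proof. by apply/crossP; split; rewrite mulrC. Qed.

Lemma scal0l p : scal 0 p = (0, 0, 0).
Proof. by rewrite /scal !mul0r. Qed.

Lemma par_scal p q : p != (0, 0, 0) -> cross p q = (0, 0, 0) -> exists k, q = scal k p.
Proof.
case: p q => [[x y] z] [[x' y'] z']; rewrite v3_eq0 => p0 /crossP /= [h1 h2 h3].
have [x0|x0] := eqVneq x 0; last first.
  exists (x' / x); apply: v3_eq; rewrite /= ?divfK //; apply: (mulfI x0).
    by rewrite h3; field.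
  by rewrite -h2; field.
have [y0|y0] := eqVneq y 0; last first.
  exists (y' / y); apply: v3_eq; rewrite /= ?divfK //; apply: (mulfI y0).
    by rewrite -h3; field.
  by rewrite h1; field.
have z0 : z != 0 by move: p0; rewrite x0 y0 !eqxx.
exists (z' / z); apply: v3_eq; rewrite /= ?divfK //; apply: (mulfI z0).
  by rewrite h2; field.
by rewrite -h1; field.
Qed.

Lemma cross_trans p q r : p != (0, 0, 0) ->
  cross p q = (0, 0, 0) -> cross p r = (0, 0, 0) -> cross q r = (0, 0, 0).
Proof.
move=> p0 h1 h2; have [k ->] := par_scal p0 h1; have [l ->] := par_scal p0 h2.
by apply/crossP; split; rewrite /=; ring.
Qed.

Lemma perp_cross p q r : dot r p = 0 -> dot r q = 0 -> cross (cross p q) r = (0, 0, 0).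
Proof.
case: p q r => [[x y] z] [[x' y'] z'] [[X Y] Z]; rewrite /dot /= => h1 h2.
apply/crossP; split=> /=.
- by apply: (lincomb2 (k := x') (k' := - x) h1 h2); ring.
- by apply: (lincomb2 (k := y') (k' := - y) h1 h2); ring.
- by apply: (lincomb2 (k := z') (k' := - z) h1 h2); ring.
Qed.

Lemma perp_scal p q r : cross p q != (0, 0, 0) -> dot r p = 0 -> dot r q = 0 ->
  exists k, r = scal k (cross p q).
Proof. by move=> n0 h1 h2; apply: par_scal n0 (perp_cross h1 h2). Qed.

Lemma perp_par p q r s : cross p q != (0, 0, 0) -> dot r p = 0 -> dot r q = 0 ->
  dot s p = 0 -> dot s q = 0 -> cross r s = (0, 0, 0).
Proof.
by move=> n0 h1 h2 h3 h4; apply: cross_trans n0 (perp_cross h1 h2) (perp_cross h3 h4).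
Qed.

Lemma qf_scal k p : qf (scal k p) = k ^+ 2 * qf p.
Proof. by rewrite /qf /=; ring. Qed.

End Vec.

Section Phi.
Variable F : finFieldType.
Implicit Types u v w g : GL2 F.

(* For D = (X, Y, Z) standing for the traceless matrix ((X, Y), (Z, -X)),
   [dot D (phi u)] is the trace of D u, and [qf D] is - \det D. *)
Definition phi u : F * F * F := (ea u - ed u, ec u, eb u).
(* This is - \det (u v - v u), which vanishes when u and v have a common eigenvector. *)
Definition delta u v := qf (cross (phi u) (phi v)).

Lemma phiV u : u \in SL2 F -> phi u^-1%g = scal (-1) (phi u).
Proof. by move=> uS; rewrite /phi !entV //; apply: v3_eq => /=; ring. Qed.

(** The cross product lists the entries (1,1), (1,2), (2,1) of u g - g u, whose last entry is minus
    the first. *)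
Lemma cent1_phi g u : (u \in 'C[g]%g) = (cross (phi g) (phi u) == (0, 0, 0)).
Proof.
rewrite cent1E; apply/eqP/eqP => [h | /crossP/= [h1 h2 h3]]; last first.
  apply: ent_eq; rewrite !entM.
  - by apply: (lincomb1 (k := 1) h1); ring.
  - by apply: (lincomb1 (k := 1) h2); ring.
  - by apply: (lincomb1 (k := 1) h3); ring.
  - by apply: (lincomb1 (k := - 1) h1); ring.
have := (congr1 (@ea F) h, congr1 (@eb F) h, congr1 (@ec F) h).
rewrite !entM /= => -[[h1 h2] h3]; apply/crossP; split=> /=.
- by apply: (lincomb1 (k := 1) h1); ring.
- by apply: (lincomb1 (k := 1) h2); ring.
- by apply: (lincomb1 (k := 1) h3); ring.
Qed.

(** Both sides are the discriminant of the characteristic polynomial. *)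
Lemma tr_disc u : u \in SL2 F ->
  tr u ^+ 2 - 4 = (phi u).1.1 ^+ 2 + 4 * ((phi u).1.2 * (phi u).2).
Proof. by move=> /SLE h; apply: (lincomb1 (k := 4) h); rewrite /tr /phi /=; ring. Qed.

Lemma phi_neq0 u : u \in SL2 F -> tr u ^+ 2 != 4 -> phi u != (0, 0, 0).
Proof.
move=> uS; apply: contraNneq => e; rewrite -subr_eq0 tr_disc // e /=.
by apply/eqP; ring.
Qed.

(** Cayley-Hamilton, u^2 = (tr u) u - 1, multiplied by v. *)
Lemma tr_SL_rec u v : u \in SL2 F -> tr (u * (u * v))%g = tr u * tr (u * v)%g - tr v.
Proof. by move=> /SLE h; rewrite /tr !entM; apply: (lincomb1 (k := - (ea v + ed v)) h); ring. Qed.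

(** Fricke's formula: the right side is tr [u, v] - 2. In this form invariance under conjugation is
    evident. *)
Lemma deltaE u v : u \in SL2 F -> v \in SL2 F ->
  delta u v = tr u ^+ 2 + tr v ^+ 2 + tr (u * v)%g ^+ 2 - tr u * tr v * tr (u * v)%g - 4.
Proof.
move=> /SLE hu /SLE hv; rewrite /tr !entM /delta /qf /cross /phi /=.
set a := ea u in hu *; set b := eb u in hu *; set c := ec u in hu *; set d := ed u in hu *.
set a' := ea v in hv *; set b' := eb v in hv *; set c' := ec v in hv *; set d' := ed v in hv *.
by apply: (lincomb2 (k := (a' + d') ^+ 2 - 4) (k' := (a + d) ^+ 2 - 4 * (a * d - b * c)) hu hv); ring.
Qed.

Lemma deltaJ u v w : u \in SL2 F -> v \in SL2 F -> w \in SL2 F ->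
  delta (u ^ w) (v ^ w) = delta u v.
Proof.
by move=> uS vS wS; rewrite !deltaE ?groupJ // -conjMg !trJ.
Qed.

Hypothesis two0 : (2 : F) != 0.

Lemma phi_tr_inj u v : phi u = phi v -> tr u = tr v -> u = v.
Proof.
rewrite /phi /tr => -[h1 h2 h3] h4; apply: ent_eq => //; apply: (mulfI two0).
  by apply: (lincomb2 (k := 1) (k' := 1) h1 h4); ring.
by apply: (lincomb2 (k := -1) (k' := 1) h1 h4); ring.
Qed.

(** Both [phi u] and [phi v] are multiples of [phi g], and equal traces give equal discriminants, so
    the factors agree up to sign; the sign -1 is inversion. *)
Lemma cent_tr_eq g u v : g \in SL2 F -> u \in SL2 F -> v \in SL2 F -> tr g ^+ 2 != 4 ->
  u \in 'C[g]%g -> v \in 'C[g]%g -> tr u = tr v -> u = v \/ u = v^-1%g.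
Proof.
move=> gS uS vS g4.
rewrite !cent1_phi => /eqP gu /eqP gv e.
have g0 := phi_neq0 gS g4.
have [k hk] := par_scal g0 gu; have [l hl] := par_scal g0 gv.
have D0 : (phi g).1.1 ^+ 2 + 4 * ((phi g).1.2 * (phi g).2) != 0 by rewrite -tr_disc // subr_eq0.
have : k ^+ 2 == l ^+ 2.
  apply/eqP/(mulIf D0).
  have := tr_disc uS; rewrite hk e (tr_disc vS) hl /= => E.
  by apply: (lincomb1 (k := -1) E); ring.
rewrite eqf_sqr => /orP[]/eqP kl; [left|right]; apply: phi_tr_inj; rewrite ?trV //.
  by rewrite hk hl kl.
by rewrite phiV // hk hl kl; apply: v3_eq => /=; ring.
Qed.

End Phi.

(** * Counting, balls and tori *)

Section Counting.
Variables T T' : finType.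
Implicit Types (A : {set T}) (B : {set T'}).

Lemma card_fibers (f : T -> T') A B k :
  {in A, forall x, f x \in B} ->
  {in B, forall y, #|[set x in A | f x == y]| <= k}%N -> (#|A| <= k * #|B|)%N.
Proof.
move=> fB fk; rewrite -sum1_card (partition_big f (mem B)) //= mulnC -sum_nat_const.
by apply: leq_sum => y /fk; rewrite -sum1dep_card.
Qed.

Lemma card_ge_pairs (A : {set T}) (B : {set T'}) (E : T -> T' -> bool) k :
  {in A, forall x, k <= #|[set y in B | E x y]|}%N ->
  (k * #|A| <= #|[set z : T * T' | [&& z.1 \in A, z.2 \in B & E z.1 z.2]]|)%N.
Proof.
move=> h; rewrite -sum1dep_card.
rewrite (eq_bigl (fun z : T * T' => (z.1 \in A) && ((z.2 \in B) && E z.1 z.2))) //.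
rewrite -(pair_big_dep (mem A) (fun x y => (y \in B) && E x y) (fun _ _ => 1%N)) /=.
rewrite mulnC -sum_nat_const; apply: leq_sum => x /h; by rewrite -sum1dep_card.
Qed.

End Counting.

Section Balls.
Variable gT : finGroupType.
Implicit Types (B : {set gT}).
Local Open Scope group_scope.

Lemma mem_expM B m n x y : x \in B ^+ m -> y \in B ^+ n -> x * y \in B ^+ (m + n).
Proof. by move=> hx hy; rewrite expgD mem_mulg. Qed.

Lemma expg_sub B m n : 1 \in B -> (m <= n)%N -> B ^+ m \subset B ^+ n.
Proof.
move=> B1 /subnKC <-; rewrite expgD; apply/subsetP => x hx.
rewrite -[x]mulg1; apply: mem_mulg => //; elim: (n - m)%N => [|k IHk]; first by rewrite expg0 set11.
by rewrite expgS -[1]mulg1 mem_mulg.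
Qed.

Lemma expg_invset B m : B^-1 = B -> (B ^+ m)^-1 = B ^+ m.
Proof.
move=> BV; elim: m => [|m IHm]; first by rewrite !expg0 invg_set1 invg1.
by rewrite {1}expgS invMg IHm BV expgSr.
Qed.

Lemma memV_exp B m x : B^-1 = B -> x \in B ^+ m -> x^-1 \in B ^+ m.
Proof. by move=> BV hx; rewrite -[B ^+ m](expg_invset m BV) mem_invg invgK. Qed.

Lemma gen_expg B : 1 \in B -> B^-1 = B -> forall x, x \in <<B>> -> exists m, x \in B ^+ m.
Proof.
move=> B1 BV x /gen_prodgP[n [c cB ->]]; exists n.
elim: n c cB => [|n IHn] c cB; first by rewrite big_ord0 expg0 set11.
by rewrite big_ord_recl expgS mem_mulg // IHn.
Qed.

Lemma expg_gen_sub B m : B ^+ m \subset <<B>>.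
Proof.
elim: m => [|m IHm]; first by rewrite expg0 sub1G.
by rewrite expgS mul_subG // subset_gen.
Qed.

End Balls.

Section Torus.
Variable F : finFieldType.
Implicit Types u v w g : GL2 F.
Hypothesis two0 : (2 : F) != 0.
Local Notation SL := (SL2 F).

Lemma card_cent_tr g t : g \in SL -> tr g ^+ 2 != 4 ->
  (#|[set u in 'C_SL[g]%g | tr u == t]| <= 2)%N.
Proof.
move=> gS g4; have [->|[u]] := set_0Vmem [set u in 'C_SL[g]%g | tr u == t].
  by rewrite cards0.
rewrite inE => /andP[/setIP[uS gu] /eqP tu].
apply: leq_trans (_ : #|[set u; u^-1%g]| <= 2)%N; last by rewrite cards2; case: eqP.
apply: subset_leq_card; apply/subsetP => v; rewrite inE => /andP[/setIP[vS gv] /eqP tv].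
apply/set2P; exact: (cent_tr_eq two0 gS vS uS g4 gv gu (etrans tv (esym tu))).
Qed.

Lemma card_cent g : g \in SL -> tr g ^+ 2 != 4 -> (#|'C_SL[g]%g| <= 2 * #|F|)%N.
Proof.
move=> gS g4; rewrite -cardsT; apply: (@card_fibers _ _ (@tr F)) => // t _.
exact: card_cent_tr.
Qed.

Lemma regE u : reg u = (tr u * (tr u ^+ 2 - 4) != 0).
Proof. by rewrite mulf_eq0 subr_eq0 negb_or. Qed.

(** Nonregular elements have one of three traces, each taken at most twice on a torus. This is the 6
    subtracted from rho below. *)
Lemma card_cent_nonreg g : g \in SL -> tr g ^+ 2 != 4 ->
  (#|[set u in 'C_SL[g]%g | ~~ reg u]| <= 6)%N.
Proof.
move=> gS g4; apply: leq_trans (_ : 2 * #|[set t in [:: 0; 2; - 2 : F]%R]| <= _)%N.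
  apply: (@card_fibers _ _ (@tr F)) => [u | t _].
    rewrite !inE => /andP[_]; rewrite negb_and !negbK.
    have -> : (4 : F) = 2 ^+ 2 by ring.
    by rewrite eqf_sqr orbA.
  apply: leq_trans (card_cent_tr t gS g4); apply: subset_leq_card.
  by apply/subsetP => u; rewrite !inE => /andP[/andP[-> _] ->].
by rewrite cardsE (leq_mul2l 2 _ 3) /= card_size.
Qed.

Lemma regJ u v : reg (u ^ v)%g = reg u.
Proof. by rewrite /reg trJ. Qed.

(** A torus consists of the elements whose [phi] lies on one line, and a regular t in it spans that
    line. *)
Lemma reg_cent g t : g \in SL -> t \in 'C_SL[g]%g -> reg g -> reg t -> 'C_SL[t]%g = 'C_SL[g]%g.
Proof.
move=> gS /setIP[tS]; rewrite cent1_phi => /eqP gt /andP[_ g4] /andP[_ t4].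
apply/setP => z; rewrite !in_setI; case: (z \in SL) => //=; rewrite !cent1_phi.
apply/eqP/eqP => h.
  exact: cross_trans (phi_neq0 tS t4) (crossC0 gt) h.
exact: cross_trans (phi_neq0 gS g4) gt h.
Qed.

End Torus.

(** * Generators move every line; a regular element in a bounded ball *)

Section Generation.
Variable F : finFieldType.
Implicit Types u v w g : GL2 F.
Local Notation SL := (SL2 F).

(* D stands for a nilpotent matrix, whose image is a line, and [dot D (phi u) = 0]
   says that u fixes this line; the conjugation by c moves it to the first axis. *)
Lemma isotropic_conj (D : F * F * F) : D != (0, 0, 0) -> qf D = 0 ->
  exists2 c, c \in SL & forall u, dot D (phi u) = 0 -> ec (u ^ c)%g = 0.
Proof.
case: D => [[X Y] Z]; rewrite v3_eq0 /qf /= => D0 hq.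
have [Z0|Z0] := eqVneq Z 0.
  have X0 : X = 0 by move/eqP: hq; rewrite Z0 mulr0 addr0 sqrf_eq0 => /eqP.
  have Y0 : Y != 0 by move: D0; rewrite Z0 X0 !eqxx andbT.
  exists 1%g => // u; rewrite conjg1 /dot /= X0 Z0 !mul0r add0r addr0 => /eqP.
  by rewrite mulf_eq0 (negPf Y0) => /eqP.
(* The first column of c is (X / Z, 1), which spans the image of D. *)
have [c [cS ca cb cc cd]] : exists u, [/\ u \in SL, ea u = X / Z, eb u = -1, ec u = 1 & ed u = 0].
  by apply: SL_ex; rewrite mulr0 mulN1r sub0r opprK.
exists c => // u; rewrite /dot /= => h.
rewrite conjgE !entM !entV // ?ca ?cb ?cc ?cd; apply: (mulfI Z0); apply: (mulfI Z0).
by apply: (lincomb2 (k := - Z) (k' := ec u) h hq); field.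
Qed.

(** The elements fixing the line of the first column of c form a subgroup, which is proper since it
    misses a conjugate of a lower unipotent matrix. *)
Lemma gen_moves (A : {set GL2 F}) c : <<A>>%g = SL -> c \in SL ->
  exists2 x, x \in A & ec (x ^ c)%g != 0.
Proof.
move=> genA cS; apply/exists_inP; apply: contraT => /exists_inPn h.
pose K := [set u in SL | ec (u ^ c)%g == 0].
have Kg : group_set K.
  apply/group_setP; split; first by rewrite in_set group1 conj1g ent1 eqxx.
  move=> u v; rewrite [u \in K]in_set [v \in K]in_set [(u * v)%g \in K]in_set.
  move=> /andP[uS /eqP hu] /andP[vS /eqP hv].
  by rewrite groupM // conjMg ecM hu hv mul0r mulr0 addr0 eqxx.
have sAS : A \subset SL by rewrite -genA subset_gen.
have : SL \subset Group Kg.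
  rewrite -genA gen_subG; apply/subsetP => x xA; rewrite in_set (subsetP sAS) //=.
  by have := h x xA; rewrite negbK.
have [w [wS wa wb wc wd]] : exists u, [/\ u \in SL, ea u = 1, eb u = 0, ec u = 1 & ed u = 1 :> F].
  by apply: SL_ex; ring.
move/subsetP/(_ (w ^ c^-1)%g); rewrite groupJ ?groupV // => /(_ isT).
by rewrite in_set conjgKV wc oner_eq0 andbF.
Qed.

Hypothesis two0 : (2 : F) != 0.
Hypothesis three0 : (3 : F) != 0.

(* If a has trace +-2 and is not scalar, the traces of the a^k b form, up to
   signs, an arithmetic progression, of which k = 0, .., 3 cannot all lie in
   {0, 2, -2}. If there is no such a, every nonscalar element of B_2 has trace 0
   and the generators normalise the cyclic group of any of them. *)
Lemma exists_reg (A : {set GL2 F}) : <<A>>%g = SL ->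
  exists2 g, g \in ((1%g |: A) ^+ 7)%g & reg g.
Proof.
move=> genA; apply/exists_inP; apply: contraT => /exists_inPn h.
set B := (1%g |: A) in h.
have B1 : 1%g \in B by rewrite setU11.
have AB x : x \in A -> x \in B by move=> hx; rewrite setU1r.
have AS x : x \in A -> x \in SL by move=> hx; rewrite -genA mem_gen.
have BS n x : x \in (B ^+ n)%g -> x \in SL.
  apply: subsetP; apply: subset_trans (expg_gen_sub _ _) _.
  by rewrite gen_subG subUset sub1G -genA subset_gen.
have nreg x : x \in (B ^+ 7)%g -> tr x ^+ 3 = 4 * tr x.
  move=> hx; have := h x hx; rewrite regE negbK => /eqP e.
  by apply: (lincomb1 (k := 1) e); ring.
have unip a : a \in (B ^+ 2)%g -> tr a ^+ 2 = 4 -> phi a = (0, 0, 0).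
  move=> aB2 a4; apply/eqP; apply: contraT => a0; have aS := BS _ _ aB2.
  have [s ts] : exists s, tr a = 2 * s by exists (tr a / 2); rewrite mulrC divfK.
  have s1 : s ^+ 2 = 1.
    apply: (mulfI two0); apply: (mulfI two0); apply: (lincomb1 (k := 1) a4); rewrite ts; ring.
  have tD b : b \in A -> s * tr (a * b)%g = tr b.
    move=> bA; have bB := AB b bA.
    have b7 := nreg b (subsetP (expg_sub (m := 1) (n := 7) B1 isT) _ bB).
    have ab3 : (a * b)%g \in (B ^+ 3)%g by apply: (mem_expM (m := 2) (n := 1)).
    have aab5 : (a * (a * b))%g \in (B ^+ 5)%g by apply: (mem_expM (m := 2) (n := 3)).
    (* The longest word needed is a^3 b with a in B^2, whence the radius 7. *)
    have aaab7 : (a * (a * (a * b)))%g \in (B ^+ 7)%g by apply: (mem_expM (m := 2) (n := 5)).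
    have t1 := nreg _ (subsetP (expg_sub (m := 3) (n := 7) B1 isT) _ ab3).
    have t2 := nreg _ (subsetP (expg_sub (m := 5) (n := 7) B1 isT) _ aab5).
    have t3 := nreg _ aaab7.
    rewrite tr_SL_rec // in t3; rewrite tr_SL_rec // ts in t2.
    rewrite tr_SL_rec // ts in t3.
    set t := tr (a * b)%g in t1 t2 t3 *; set t0 := tr b in b7 t2 t3 *.
    (* The common difference: s^k tr (a^k b) = t0 + k e, since s^2 = 1 and the trace recurrence has
       coefficients 2 s and -1. *)
    pose e := s * t - t0.
    have cube (y z : F) : z ^+ 3 = 4 * z -> s * z = y -> y ^+ 3 = 4 * y.
      by move=> hz <-; apply: (lincomb2 (k := s ^+ 3) (k' := 4 * (s * z)) hz s1); ring.
    have w1 : (t0 + e) ^+ 3 = 4 * (t0 + e) by apply: cube t1 _; rewrite /e; ring.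
    have w2 : (t0 + 2 * e) ^+ 3 = 4 * (t0 + 2 * e).
      by rewrite (_ : t0 + 2 * e = 2 * s * t - t0) // /e; ring.
    have w3 : (t0 + 3 * e) ^+ 3 = 4 * (t0 + 3 * e).
      apply: cube t3 _; apply: (lincomb1 (k := 2 * (2 * s * t - t0)) s1); rewrite /e; ring.
    (* The third difference of z^3 - 4 z along the progression is 6 e^3. *)
    have : 2 * 3 * e ^+ 3 = 0.
      by apply: (lincomb4 (k := 1) (k' := - 3) (k2 := 3) (k3 := - 1) w3 w2 w1 b7); ring.
    move/eqP; rewrite mulf_eq0 (mulf_eq0 2) (negPf two0) (negPf three0) expf_eq0 /= => /eqP.
    by rewrite /e => /eqP; rewrite subr_eq0 => /eqP.
  have aE := SLE aS.
  (* The matrix a - s is nilpotent, and [tD] says tr ((a - s) b) = 0 for each generator b: all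
     generators would fix its image. *)
  have D0 : (ea a - s, eb a, ec a) != (0, 0, 0).
    apply: contra a0; rewrite !v3_eq0 /= => /and3P[/eqP h1 -> ->]; rewrite !andbT.
    by apply/eqP; apply: (lincomb2 (k := -1) (k' := 2) ts h1); rewrite /tr; ring.
  have [|c cS hc] := isotropic_conj D0.
    suff : (ea a - s) ^+ 2 + eb a * ec a = 0 by [].
    by apply: (lincomb3 (k := -1) (k' := 1) (k2 := ea a) aE s1 ts); rewrite /tr; ring.
  have [x xA] := gen_moves genA cS; rewrite hc ?eqxx //.
  have := tD x xA; rewrite /dot /phi /tr !entM /= => hx.
  rewrite /tr in ts.
  by apply: (lincomb3 (k := s) (k' := - (ea a * ea x + eb a * ec x + (ec a * eb x + ed a * ed x)))
               (k2 := - ed x) hx s1 ts); ring.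
have [x xA xc] := gen_moves genA (group1 SL); rewrite conjg1 in xc.
have B12 y : y \in A -> y \in (B ^+ 2)%g.
  by move=> /AB; apply: subsetP (expg_sub (m := 1) (n := 2) B1 isT) _.
have sc y : y \in (B ^+ 2)%g -> phi y = (0, 0, 0) \/ tr y = 0.
  move=> yB; have := h y (subsetP (expg_sub (m := 2) (n := 7) B1 isT) _ yB).
  by rewrite negb_and !negbK => /orP[]/eqP; [right | left; apply: unip].
have xS := AS x xA.
have x0 : tr x = 0.
  by case: (sc x (B12 x xA)) => // e; move: xc; rewrite [ec x](congr1 (fun p => p.1.2) e) eqxx.
have four0 : (0 : F) != 4.
  have -> : (4 : F) = 2 * 2 by ring.
  by rewrite eq_sym mulf_neq0.
have Nx : SL \subset 'N(<[x]>)%g.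
  rewrite -genA gen_subG; apply/subsetP => g gA; rewrite -cycle_subG norms_cycle.
  have gS := AS g gA.
  have C1 : g \in 'C[x]%g -> (x ^ g)%g \in <[x]>%g.
    by move=> /cent1P xg; rewrite conjgE -xg mulKg cycle_id.
  case: (sc g (B12 g gA)) => [g0|g0].
    by apply: C1; rewrite cent1_phi g0 /cross /= !mulr0 subrr.
  have xg2 : (x * g)%g \in (B ^+ 2)%g by apply: (mem_expM (m := 1) (n := 1)); apply: AB.
  case: (sc _ xg2) => [xg0|xg0].
    apply: C1; have : (x * g)%g \in 'C[x]%g by rewrite cent1_phi xg0 /cross /= !mulr0 subrr.
    by rewrite groupMl // cent1id.
  suff e : (x * g = g * x^-1)%g by rewrite conjgE e mulKg groupV cycle_id.
  rewrite /tr in g0; rewrite /tr !entM in xg0.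
  apply: ent_eq; rewrite !entM !entV //.
  - by apply: (lincomb2 (k := 1) (k' := - ed x) xg0 g0); ring.
  - by apply: (lincomb1 (k := eb x) g0); ring.
  - by apply: (lincomb1 (k := ec x) g0); ring.
  - by apply: (lincomb2 (k := 1) (k' := - ea x) xg0 g0); ring.
(* The conjugate of x by a unipotent w lies in the cyclic group of x and has the same trace, so it
   is x or its inverse; [ec x] nonzero excludes both. *)
have [w [wS wa wb wc wd]] : exists u, [/\ u \in SL, ea u = 1, eb u = 1, ec u = 0 & ed u = 1 :> F].
  by apply: SL_ex; ring.
have xw : (x ^ w)%g \in 'C[x]%g.
  have := subsetP Nx w wS; rewrite -cycle_subG norms_cycle => /cycleP[n ->].
  by rewrite groupX // cent1id.
have x4 : tr x ^+ 2 != 4 by rewrite x0 expr0n.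
have := cent_tr_eq two0 xS (groupJ xS wS) xS x4 xw (cent1id x) (trJ x w).
case=> e.
  have := congr1 (@ea F) e; rewrite conjgE !entM !entV // ?wa ?wb ?wc ?wd => E.
  by case/eqP: xc; apply: (lincomb1 (k := -1) E); ring.
have := congr1 (@ec F) e; rewrite conjgE !entM !entV // ?wa ?wb ?wc ?wd => E.
by case/eqP: xc; apply: (mulfI two0); apply: (lincomb1 (k := 1) E); ring.
Qed.

End Generation.

Lemma double_count (T T' : finType) (A : {set T}) (B : {set T'}) (E : T -> T' -> bool) k l :
  {in A, forall x, k <= #|[set y in B | E x y]|}%N ->
  {in B, forall y, #|[set x in A | E x y]| <= l}%N -> (k * #|A| <= l * #|B|)%N.
Proof.
move=> hk hl; apply: (@leq_trans (\sum_(x in A) \sum_(y in B | E x y) 1)).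
  by rewrite mulnC -sum_nat_const; apply: leq_sum => x /hk; rewrite -sum1dep_card.
rewrite (exchange_big_dep (mem B)) /=; last by move=> x y _ /andP[].
rewrite mulnC -sum_nat_const; apply: leq_sum => y /[dup] yB /hl.
by rewrite -sum1dep_card; under [X in (_ -> X <= _)%N]eq_bigl do rewrite yB andTb.
Qed.

(** * Poor tori, or quadratically many elements *)

Section Pivot.
Variable F : finFieldType.
Implicit Types u v w g t : GL2 F.
Local Notation SL := (SL2 F).
Hypothesis two0 : (2 : F) != 0.
Hypothesis three0 : (3 : F) != 0.

Lemma cent_SLJ g c : c \in SL -> ('C_SL[g ^ c] = 'C_SL[g] :^ c)%g.
Proof. by move=> cS; rewrite conjIg cent1J conjGid. Qed.

Lemma card_conj_fiber g z : g \in SL -> (#|[set c in SL | (g ^ c)%g == z]| <= #|'C_SL[g]%g|)%N.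
Proof.
move=> gS; have [->|[c0]] := set_0Vmem [set c in SL | (g ^ c)%g == z]; first by rewrite cards0.
rewrite in_set => /andP[c0S /eqP e0].
rewrite -(card_imset _ (mulIg c0^-1%g)); apply: subset_leq_card; apply/subsetP => _ /imsetP[c + ->].
rewrite in_set => /andP[cS /eqP e]; rewrite in_setI groupM ?groupV //=.
have E : (g ^ (c * c0^-1) = g)%g by rewrite conjgM e -e0 conjgK.
by apply/cent1P; rewrite /commute [RHS]conjgC E.
Qed.

Variable A : {set GL2 F}.
Hypothesis genA : <<A>>%g = SL.
Hypothesis symA : (A^-1)%g = A.
Local Notation B := (1%g |: A).

Lemma ball_SL n : (B ^+ n)%g \subset SL.
Proof.
by apply: subset_trans (expg_gen_sub _ _) _; rewrite gen_subG subUset sub1G -genA subset_gen.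
Qed.

Lemma ball1 : 1%g \in B. Proof. exact: setU11. Qed.

Lemma ballV : (B^-1)%g = B.
Proof. by rewrite invUg invg_set1 invg1 symA. Qed.

Lemma ball_all x : x \in SL -> exists k, x \in (B ^+ k)%g.
Proof.
move=> xS; apply: gen_expg ball1 ballV _ _.
by rewrite -genA in xS; apply: subsetP xS; apply: genS; apply: subsetUr.
Qed.

Lemma ball_conj n k x y : x \in (B ^+ n)%g -> y \in (B ^+ k)%g -> (x ^ y)%g \in (B ^+ (k + n + k))%g.
Proof.
by move=> hx hy; rewrite conjgE mulgA; do 2?apply: mem_expM => //; apply: memV_exp ballV _.
Qed.

(* If no torus met by the ball of radius n + 2 is poor, richness propagates along
   the generators to all conjugates of one torus, and distinct tori share no regular element. *)
Lemma poor_torus_or_quadratic n rho : (7 <= n)%N -> (7 <= rho)%N ->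
  (exists h, [/\ h \in (B ^+ (n + 2))%g, reg h & #|(B ^+ n :&: 'C_SL[h])%g| < rho]%N) \/
  ((rho - 6) * #|SL| <= 4 * #|F| * #|(B ^+ n)%g|)%N.
Proof.
move=> n7 rho7.
have [/exists_inP[h hB /andP[hr hc]]|/exists_inPn hyp] :=
  boolP [exists h in (B ^+ (n + 2))%g, reg h && (#|(B ^+ n :&: 'C_SL[h])%g| < rho)%N].
  by left; exists h.
right.
have {}hyp h : h \in (B ^+ (n + 2))%g -> reg h -> (rho <= #|(B ^+ n :&: 'C_SL[h])%g|)%N.
  by move=> /hyp; rewrite negb_and => /orP[/negPf-> //|]; rewrite -leqNgt.
have [g gB gr] := exists_reg two0 three0 genA.
have gS : g \in SL by apply: subsetP (ball_SL 7) _ gB.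
have many c : c \in SL -> (rho <= #|(B ^+ n :&: 'C_SL[g ^ c])%g|)%N ->
    (rho - 6 <= #|[set t in (B ^+ n)%g | reg t && (t \in 'C_SL[g ^ c]%g)]|)%N.
  move=> cS hc; have := card_cent_nonreg two0 (groupJ gS cS).
  rewrite trJ => /(_ (proj2 (andP gr))) h6.
  rewrite leq_subLR; apply: leq_trans hc _; rewrite addnC.
  rewrite -(cardsID [set t | reg t] (B ^+ n :&: 'C_SL[g ^ c])%g).
  apply: leq_add; last first.
    apply: leq_trans h6; apply: subset_leq_card; apply/subsetP => t.
    by rewrite in_setD [t \in _ :&: _]in_setI !in_set => /andP[-> /andP[_ ->]].
  apply: subset_leq_card; apply/subsetP => t.
  by rewrite in_setI [t \in _ :&: _]in_setI !in_set => /andP[/andP[-> ->] ->].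
have rich k : forall c, c \in (B ^+ k)%g -> (rho <= #|(B ^+ n :&: 'C_SL[g ^ c])%g|)%N.
  elim: k => [|k IHk] c.
    rewrite expg0 => /set1P->; rewrite conjg1; apply: hyp => //.
    by apply: subsetP gB; apply: expg_sub ball1 _; apply: leq_trans n7 (leq_addr _ _).
  rewrite expgSr => /mulsgP[c' a c'B aB ->]; rewrite conjgM.
  have c'S : c' \in SL by apply: subsetP (ball_SL k) _ c'B.
  have aS : a \in SL by apply: subsetP (ball_SL 1) _ aB.
  have := many c' c'S (IHk c' c'B) => h.
  have /card_gt0P[t] : (0 < #|[set t in (B ^+ n)%g | reg t && (t \in 'C_SL[g ^ c']%g)]|)%N.
    by apply: leq_trans h; rewrite subn_gt0.
  rewrite in_set => /and3P[tB tr_t tC].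
  (* The conjugator c' may be long, but t has the same torus as g^c' and t^a lies in the ball of
     radius n + 2, so the assumption applies to t^a. *)
  rewrite cent_SLJ // -(reg_cent (groupJ gS c'S) tC _ tr_t) ?regJ // -cent_SLJ //.
  apply: hyp; rewrite ?regJ //.
  rewrite -[2%N]/(1 + 1)%N addnA (addnC n 1%N).
  exact: ball_conj.
apply: (@double_count _ _ SL (B ^+ n)%g (fun c t => reg t && (t \in 'C_SL[g ^ c]%g))).
  move=> c cS; have [k ck] := ball_all cS; exact: many (rich k c ck).
move=> t tB; have tS : t \in SL by apply: subsetP (ball_SL n) _ tB.
have [rt|rt] := boolP (reg t); last by rewrite (_ : [set _ in _ | _] = set0) ?cards0 //; apply/setP => c; rewrite !inE andbF.
have t4 := proj2 (andP rt); have g4 := proj2 (andP gr).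
(* If t centralises g^c, then g^c lies in the torus of t with the trace of g: two values, each taken
   for at most 2 |F| choices of c. *)
apply: (@leq_trans ((2 * #|F|) * #|[set z in 'C_SL[t]%g | tr z == tr g]|)%N); last first.
  by rewrite mulnC mulnA leq_mul2r (leq_mul2r 2 _ 2) card_cent_tr ?orbT.
apply: (card_fibers (f := fun c => (g ^ c)%g)) => [c | z _].
  rewrite in_set => /and3P[cS _ /setIP[_ tC]].
  by rewrite in_set in_setI groupJ //= cent1C tC trJ eqxx.
apply: leq_trans (card_cent two0 gS g4); apply: leq_trans (card_conj_fiber z gS).
by apply: subset_leq_card; apply/subsetP => c; rewrite !in_set => /andP[/andP[-> _] ->].
Qed.

End Pivot.

(** * Growth below |F|^2 *)

Lemma card_le2 (T : finType) (E : {set T}) :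
  (forall x y z, x \in E -> y \in E -> z \in E -> y != x -> z != x -> y = z) -> (#|E| <= 2)%N.
Proof.
move=> h; have [->|[x xE]] := set_0Vmem E; first by rewrite cards0.
rewrite (cardsD1 x) xE ltnS; apply/card_le1_eqP => y z.
by rewrite !in_setD1 => /andP[yx yE] /andP[zx zE]; apply: (h x z y).
Qed.

Lemma card_quadratic (F : finFieldType) (a b c : F) : a != 0 ->
  (#|[set t : F | a * t ^+ 2 + b * t + c == 0]%R| <= 2)%N.
Proof.
move=> a0; apply: card_le2 => x y z; rewrite !in_set => /eqP hx /eqP hy /eqP hz yx zx.
have k t : a * t ^+ 2 + b * t + c = 0 -> t != x -> a * (t + x) + b = 0.
  move=> ht tx; apply: (mulfI (x := t - x)); first by rewrite subr_eq0.
  by apply: (lincomb2 (k := 1) (k' := - 1) ht hx); ring.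
by apply: (mulfI a0); apply: (lincomb2 (k := 1) (k' := - 1) (k y hy yx) (k z hz zx)); ring.
Qed.

(** * Lines on the quadric det = 1 and the fibres of the quotient map *)

Section Fibres.
Variable F : finFieldType.
Implicit Types u v w g t : GL2 F.
Local Notation SL := (SL2 F).

Lemma delta_cross0 u v : cross (phi u) (phi v) = (0, 0, 0) -> delta u v = 0.
Proof. by rewrite /delta => ->; rewrite /qf /=; ring. Qed.

(** Vectors orthogonal to both are multiples of the cross product, on which [qf] takes the value
    [delta u v]. *)
Lemma isotropic_perp_eq0 u v (D : F * F * F) : delta u v != 0 ->
  dot D (phi u) = 0 -> dot D (phi v) = 0 -> qf D = 0 -> D = (0, 0, 0).
Proof.
move=> d0 hu hv; have c0 : cross (phi u) (phi v) != (0, 0, 0).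
  by apply: contraNneq d0 => /delta_cross0 ->.
have [k ->] := perp_scal c0 hu hv; rewrite qf_scal => /eqP.
by rewrite mulf_eq0 (negPf d0) orbF expf_eq0 /= => /eqP->; rewrite scal0l.
Qed.

(** For equal traces this is v - u in the coordinates (X, Y, Z) of a traceless matrix. *)
Definition diffv u v : F * F * F := (ea v - ea u, eb v - eb u, ec v - ec u).

Lemma diffv_inj u v w : tr v = tr w -> diffv u v = diffv u w -> v = w.
Proof.
rewrite /tr => e [/addIr h1 /addIr h2 /addIr h3]; apply: ent_eq => //.
by move: e; rewrite h1 => /addrI.
Qed.

Lemma diffvv u : diffv u u = (0, 0, 0).
Proof. by rewrite /diffv !subrr. Qed.

(** The expansion of det (u + D) = det u for D = v - u. *)
Lemma diffv_det u v : u \in SL -> v \in SL -> tr v = tr u ->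
  qf (diffv u v) + dot (diffv u v) (phi u) = 0.
Proof.
move=> /SLE hu /SLE hv; rewrite /tr /qf /dot /diffv /phi /= => e.
by apply: (lincomb3 (k := 1) (k' := - 1) (k2 := ea v) hu hv e); ring.
Qed.

Lemma diffv_dot u v y : tr v = tr u ->
  dot (diffv u v) (phi y) = tr (v * y)%g - tr (u * y)%g.
Proof.
rewrite /tr !entM /dot /diffv /phi /= => e.
by apply: (lincomb1 (k := - ed y) e); ring.
Qed.

(** The line through u and v meets the quadric det = 1 in no third point unless it lies on it, which
    is the last alternative. *)
Lemma diffv_scal u v w k : u \in SL -> v \in SL -> w \in SL -> tr v = tr u -> tr w = tr u ->
  v != u -> diffv u w = scal k (diffv u v) ->
  [\/ w = u, w = v | qf (diffv u v) = 0 /\ dot (diffv u v) (phi u) = 0].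
Proof.
move=> uS vS wS ev ew vu hk; have hv := diffv_det uS vS ev; have := diffv_det uS wS ew.
rewrite hk qf_scal => hw.
have : k * (k - 1) * qf (diffv u v) = 0.
  by rewrite /dot /= in hw hv; apply: (lincomb2 (k := 1) (k' := - k) hw hv); ring.
move/eqP; rewrite !mulf_eq0 subr_eq0 -orbA => /or3P[]/eqP e.
- by constructor 1; apply: (@diffv_inj u) => //; rewrite hk e scal0l diffvv.
- constructor 2; apply: (@diffv_inj u); rewrite ?ev // hk e.
  by apply: v3_eq; rewrite /= mul1r.
- by constructor 3; move: hv; rewrite e add0r.
Qed.

(* The u with prescribed u y and u z in the conjugacy class lie on an affine line,
   which meets \det u = 1 in at most two points unless its direction D has
   \det D = 0 = tr (D u^-1); [delta u (u * y) != 0] rules this out. *)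
Lemma fibre_unique u v w y z : u \in SL -> v \in SL -> w \in SL -> y \in SL ->
  tr v = tr u -> tr w = tr u ->
  tr (v * y)%g = tr (u * y)%g -> tr (w * y)%g = tr (u * y)%g ->
  tr (v * z)%g = tr (u * z)%g -> tr (w * z)%g = tr (u * z)%g ->
  cross (phi y) (phi z) != (0, 0, 0) -> delta u (u * y)%g != 0 ->
  v != u -> w != u -> v = w.
Proof.
move=> uS vS wS yS ev ew vy wy vz wz yz d0 vu wu.
have D0 : diffv u v != (0, 0, 0).
  by apply: contra vu => /eqP e; apply/eqP/(@diffv_inj u) => //; rewrite diffvv.
have hy : dot (diffv u v) (phi y) = 0 by rewrite diffv_dot // vy subrr.
have hz : dot (diffv u v) (phi z) = 0 by rewrite diffv_dot // vz subrr.
have hy' : dot (diffv u w) (phi y) = 0 by rewrite diffv_dot // wy subrr.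
have hz' : dot (diffv u w) (phi z) = 0 by rewrite diffv_dot // wz subrr.
have [k hk] := par_scal D0 (perp_par yz hy hz hy' hz').
have [e|//|[q0 p0]] := diffv_scal uS vS wS ev ew vu hk; first by rewrite e eqxx in wu.
case/eqP: D0; move: hy q0 p0; case: (diffv u v) => [[X Y] Z] hy q0 p0.
have hu := SLE uS.
(* E is D u^-1: traceless, of determinant 0, and orthogonal to u and u y because tr (E u) = tr D = 0
   and tr (E u y) = tr (D y) = 0. *)
pose E := (X * ed u - Y * ec u, Y * ea u - X * eb u, Z * ed u + X * ec u).
have [E1 E2 E3] : E = (0, 0, 0).
  apply: (isotropic_perp_eq0 d0); rewrite /E /dot /phi /qf /= in hy q0 p0 *.
  - by apply: (lincomb1 (k := ed u) p0); ring.
  - rewrite !entM.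
    by apply: (lincomb3 (k := 1) (k' := ec u * eb y + ed u * ed y)
      (k2 := X * (ea y - ed y) + Y * ec y + Z * eb y) hy p0 hu); ring.
  - by apply: (lincomb2 (k := ea u * ed u - eb u * ec u) (k' := - (X * ed u - Y * ec u)) q0 p0); ring.
rewrite /dot /phi /= in p0; apply: v3_eq => /=.
- by apply: (lincomb3 (k := ea u) (k' := ec u) (k2 := - X) E1 E2 hu); ring.
- by apply: (lincomb3 (k := eb u) (k' := ed u) (k2 := - Y) E1 E2 hu); ring.
- by apply: (lincomb4 (k := ea u) (k' := - ec u) (k2 := - ec u) (k3 := - Z) E3 E1 p0 hu); ring.
Qed.

(** Parallel quotients put w in the linear span of u and v, and equal nonzero traces put it on the
    affine line through them. That line is not on the quadric, as [delta u v] is nonzero. *)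
Lemma plane_points u v w : u \in SL -> v \in SL -> w \in SL ->
  tr v = tr u -> tr w = tr u -> tr u != 0 -> delta u v != 0 ->
  cross (phi (u^-1 * v)%g) (phi (u^-1 * w)%g) = (0, 0, 0) -> w = u \/ w = v.
Proof.
move=> uS vS wS ev ew t0 d0.
move: (mulKVg u v) (mulKVg u w); move: (u^-1 * v)%g (u^-1 * w)%g => y z /esym vE /esym wE yz.
have y0 : phi y != (0, 0, 0).
  apply: contraNneq d0 => e; apply/eqP/delta_cross0/eqP; rewrite -cent1_phi vE.
  by rewrite groupMl ?cent1id // cent1_phi e /cross /= !mulr0 subrr.
have [k hk] := par_scal y0 yz.
have := hk; rewrite /phi /scal /= => -[k1 k2 k3].
have [a az] : exists a, ea z = a + k * ea y by exists (ea z - k * ea y); rewrite subrK.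
have wa : ea w = a * ea u + k * ea v.
  by rewrite wE vE !entM az k2; ring.
have wb : eb w = a * eb u + k * eb v.
  by rewrite az in k1; rewrite wE vE !entM k3; apply: (lincomb1 (k := - eb u) k1); ring.
have wc : ec w = a * ec u + k * ec v.
  by rewrite wE vE !entM az k2; ring.
have wd : ed w = a * ed u + k * ed v.
  by rewrite az in k1; rewrite wE vE !entM k3; apply: (lincomb1 (k := - ed u) k1); ring.
have ak : a = 1 - k.
  apply: (mulIf t0); have : tr w = a * tr u + k * tr v by rewrite /tr wa wd; ring.
  by rewrite ew ev => h; apply: (lincomb1 (k := - 1) h); ring.
have D : diffv u w = scal k (diffv u v).
  by rewrite /diffv wa wb wc ak; apply: v3_eq => /=; ring.
have vu : v != u by apply: contraNneq d0 => ->; rewrite delta_cross0 ?crossxx.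
have [->|->|[q0 p0]] := diffv_scal uS vS wS ev ew vu D; [by left|by right|].
have p1 : dot (diffv u v) (phi v) = 0.
  rewrite /dot /diffv /phi /qf /= in q0 p0 *; rewrite /tr in ev.
  by apply: (lincomb3 (k := 2) (k' := 1) (k2 := - (ea v - ea u)) q0 p0 ev); ring.
case/eqP: vu; apply: (@diffv_inj u) => //; rewrite diffvv.
exact: isotropic_perp_eq0 d0 p0 p1 q0.
Qed.

(* (u, v, w) is recovered up to two choices from (u^-1 v, u^-1 w). *)
Lemma triple_count (S1 S2 S3 M1 M2 : {set GL2 F}) (s : F) : s != 0 ->
  {in S1, forall u, u \in SL /\ tr u = s} -> {in S2, forall u, u \in SL /\ tr u = s} ->
  {in S3, forall u, u \in SL /\ tr u = s} ->
  {in S1 & S2, forall u v, (u^-1 * v)%g \in M1} -> {in S1 & S3, forall u v, (u^-1 * v)%g \in M2} ->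
  ((#|S3| - 2) * #|[set p : GL2 F * GL2 F | [&& p.1 \in S1, p.2 \in S2 & delta p.1 p.2 != 0%R]]|
    <= 2 * (#|M1| * #|M2|))%N.
Proof.
move=> s0 h1 h2 h3 hM1 hM2; rewrite -cardsX.
pose E (p q : GL2 F * GL2 F) := [&& q.1 == (p.1^-1 * p.2)%g, (p.1 * q.2)%g \in S3
   & cross (phi q.1) (phi q.2) != (0, 0, 0)].
apply: (@double_count _ _ _ _ E) => [[u v]|[y z]].
  rewrite in_set /= => /and3P[uS1 vS2 d0].
  have [uS tu] := h1 u uS1; have [vS tv] := h2 v vS2.
  (* By [plane_points] only w = u and w = v give parallel quotients, hence the - 2. *)
  apply: (@leq_trans #|S3 :\: [set u; v]|).
    rewrite leq_subLR addnC -(cardsID [set u; v] S3) addnC leq_add2l.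
    apply: leq_trans (subset_leq_card (subsetIr _ _)) _; rewrite cards2.
    by case: (u != v).
  have inj : injective (fun w => (u^-1 * v, u^-1 * w)%g) by move=> w w' /(congr1 snd) /mulgI.
  rewrite -(card_imset _ inj); apply: subset_leq_card; apply/subsetP => _ /imsetP[w + ->].
  rewrite in_setD in_set2 negb_or => /andP[/andP[wu wv] wS3]; have [wS tw] := h3 w wS3.
  rewrite in_set in_setX /= hM1 // hM2 //= /E /= eqxx mulKVg wS3 /=.
  apply: contraNneq wu => c0.
  have [|||->|e] := plane_points uS vS wS _ _ _ d0 c0; rewrite ?tu ?tv ?tw //.
  by rewrite e eqxx in wv.
move=> _; apply: (@leq_trans #|[set u in S1 | [&& (u * y)%g \in S2, delta u (u * y)%g != 0,
    (u * z)%g \in S3 & cross (phi y) (phi z) != (0, 0, 0)]]|).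
  have inj : injective (fun u => (u, u * y)%g) by move=> u u' /(congr1 fst).
  rewrite -(card_imset _ inj); apply: subset_leq_card; apply/subsetP => -[u v].
  rewrite !in_set /E /= => /andP[/and3P[uS1 vS2 d0] /and3P[/eqP ye zS3 c0]].
  have vE : v = (u * y)%g by rewrite ye mulKVg.
  apply/imsetP; exists u; rewrite ?vE //.
  by rewrite in_set uS1 -vE vS2 d0 zS3 c0.
apply: card_le2 => u v w; rewrite !in_set.
move=> /and5P[/h1[uS tu] /h2[uyS tuy] d0 /h3[_ tuz] c0].
move=> /and5P[/h1[vS tv] /h2[_ tvy] _ /h3[_ tvz] _].
move=> /and5P[/h1[wS tw] /h2[_ twy] _ /h3[_ twz] _].
apply: (fibre_unique (u := u) (y := y) (z := z)); rewrite ?tu ?tuy ?tuz //.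
by rewrite -(mulKg u y) groupM ?groupV.
Qed.

End Fibres.

Lemma more_than_quarter (b m k l : nat) : (m < 2 * b)%N -> (b <= k + l)%N -> (4 * k < m)%N -> (m <= 4 * l)%N.
Proof. lia. Qed.

(** The threshold 48 gives m >= 12, where (m - 4) (m - 2) >= m^2 / 2; the factor is 32 = 2 * 4^2. *)
Lemma quarter_pairs (m n : nat) : (48 <= n)%N -> (n <= 4 * m)%N ->
  (n ^ 2 <= 32 * ((m - 4) * (m - 2)))%N.
Proof.
move=> n48 nm; apply: (@leq_trans ((4 * m) ^ 2)); first by rewrite leq_sqr.
have [k ->] : exists k, m = (k + 12)%N by exists (m - 12)%N; lia.
by rewrite -!mulnn -(addnBA k) // -(addnBA k) //=; nia.
Qed.

(** * Pairs of conjugates without a common fixed line *)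

Section GoodPairs.
Variable F : finFieldType.
Implicit Types u v w g x : GL2 F.
Local Notation SL := (SL2 F).
Hypothesis two0 : (2 : F) != 0.

Lemma upper_ea_root u : u \in SL -> ec u = 0 -> 1 * ea u ^+ 2 + - tr u * ea u + 1 = 0.
Proof. by move=> /SLE h c0; apply: (lincomb2 (k := - 1) (k' := - eb u) h c0); rewrite /tr; ring. Qed.

Lemma upper_inj u v : tr u = tr v -> ec u = 0 -> ec v = 0 -> ea u = ea v -> eb u = eb v -> u = v.
Proof.
rewrite /tr => ht hu hv ha hb; apply: ent_eq; rewrite ?hu ?hv //.
by move: ht; rewrite ha => /addrI.
Qed.

Lemma upper_neq u : u \in SL -> ec u = 0 -> tr u ^+ 2 != 4 -> ea u - ed u != 0.
Proof.
move=> uS c0; rewrite -subr_eq0 tr_disc // /phi /= c0 mul0r mulr0 addr0.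
by rewrite expf_eq0.
Qed.

Lemma ec_conj_upper x u : x \in SL -> ec u = 0 ->
  ec (x * u * x^-1)%g = ec x * (ed x * (ea u - ed u) - ec x * eb u).
Proof. by move=> xS c0; rewrite !entM !entV // c0; ring. Qed.

(* For u and v upper triangular, an x moving the common fixed point separates
   their fixed points, up to six exceptions per element. *)
Lemma upper_pairs (S : {set GL2 F}) (s : F) x c : c \in SL -> x \in SL ->
  {in S, forall u, [/\ u \in SL, tr u = s & ec (u ^ c)%g = 0]} -> s ^+ 2 != 4 ->
  ec (x ^ c)%g != 0 ->
  ((#|S| - 4) * (#|S| - 2) <=
    #|[set p : GL2 F * GL2 F | [&& p.1 \in S, p.2 \in S & delta p.1 (p.2 ^ x)%g != 0%R]]|)%N.
Proof.
move=> cS xS hS s4 xc.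
pose U u := (u ^ c)%g; pose X := (x ^ c)%g.
have US u : u \in S -> [/\ U u \in SL, tr (U u) = s & ec (U u) = 0].
  by move=> /hS[uS ts uc]; rewrite groupJ // trJ.
have Uinj u v : u \in S -> v \in S -> ea (U u) = ea (U v) -> eb (U u) = eb (U v) -> u = v.
  move=> /US[_ tu cu] /US[_ tv cv] ha hb; apply: (conjg_inj c).
  by apply: upper_inj; rewrite ?tu ?tv ?cu ?cv.
pose Rt := [set t : F | 1 * t ^+ 2 + - s * t + 1 == 0].
have Rt2 : (#|Rt| <= 2)%N by apply: card_quadratic; exact: oner_neq0.
have URt u : u \in S -> ea (U u) \in Rt.
  by move=> /US[uS tu cu]; rewrite in_set -tu upper_ea_root.
have XS : X \in SL by rewrite groupJ.
pose W u := (X * U u * X^-1)%g.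
have WE u : u \in S -> ec (W u) = ec X * (ed X * (ea (U u) - ed (U u)) - ec X * eb (U u)).
  by move=> /US[_ _ cu]; exact: ec_conj_upper.
(* These u fix a second line, the one X takes to the first axis; they are determined by their
   eigenvalue on the first, a root of a quadratic. *)
pose E := [set u in S | ec (W u) == 0].
have E2 : (#|E| <= 2)%N.
  rewrite -(card_in_imset (f := fun u => ea (U u))).
    apply: leq_trans Rt2; apply: subset_leq_card; apply/subsetP => _ /imsetP[u + ->].
    by rewrite in_set => /andP[/URt].
  move=> u v; rewrite !in_set => /andP[uS /eqP hu] /andP[vS /eqP hv] ha.
  apply: Uinj => //; move: hu hv; rewrite !WE // => /eqP; rewrite mulf_eq0 (negPf xc) /= => /eqP hu.
  move=> /eqP; rewrite mulf_eq0 (negPf xc) /= => /eqP hv.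
  have [_ tu _] := US u uS; have [_ tv _] := US v vS.
  rewrite /tr in tu tv; apply: (mulfI xc); rewrite -/X.
  by apply: (lincomb4 (k := - 1) (k' := 1) (k2 := - ed X) (k3 := ed X) hu hv tu tv); rewrite ha; ring.
(* For a given eigenvalue of v, delta is [ec (W u)] times a quadratic in [eb (U v)] with leading
   coefficient [ec (W u)]: two values for each of two eigenvalues. *)
have bad u : u \in S :\: E -> (#|[set v in S | delta u (v ^ x)%g == 0%R]| <= 4)%N.
  rewrite in_setD in_set => /andP[+ uS]; rewrite uS /= => Wc.
  apply: (@leq_trans (2 * #|Rt|)); last by rewrite (leq_mul2l 2 _ 2).
  apply: (card_fibers (f := fun v => ea (U v))) => [v | t _].
    by rewrite in_set => /andP[/URt].
  pose d' := s - t; pose z := t - d'.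
  pose w := phi (W u).
  apply: leq_trans (card_quadratic (w.1.1 * z) (- (w.2 * z ^+ 2)) Wc).
  rewrite -(card_in_imset (f := fun v => eb (U v))).
    apply: subset_leq_card; apply/subsetP => _ /imsetP[v + ->].
    rewrite !in_set => /andP[/andP[vS /eqP dv] /eqP et].
    have [VS tv cv] := US v vS; have [uSL _ _] := hS u uS; have [vSL _ _] := hS v vS.
    have : delta (W u) (U v) = 0.
      have -> : W u = (U u ^ X^-1)%g by rewrite conjgE invgK mulgA.
      rewrite -(deltaJ (w := X)) ?groupJ ?groupV // conjgKV -conjJg deltaJ ?groupJ //.
    rewrite /delta /qf /cross [phi (U v)]/phi /= cv et -/w.
    have -> : ed (U v) = d' by rewrite /d' -tv /tr et; ring.
    rewrite -/z => h; apply/eqP/(mulfI Wc); rewrite mulr0 -[RHS]h -[ec (W u)]/(w.1.2).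
    by ring.
  move=> v v'; rewrite !in_set => /andP[/andP[vS _] /eqP et] /andP[/andP[v'S _] /eqP et'] hb.
  by apply: Uinj; rewrite // et et'.
apply: (@leq_trans ((#|S| - 4) * #|S :\: E|)).
  by rewrite leq_mul2l leq_subLR addnC -(cardsID E S) addnC leq_add2l
    (leq_trans (subset_leq_card (subsetIr _ _)) E2) orbT.
apply: leq_trans (card_ge_pairs (B := S) (E := fun u v => delta u (v ^ x)%g != 0) _) _.
  move=> u /bad h; rewrite leq_subLR -(cardsID [set v | delta u (v ^ x)%g == 0] S).
  apply: leq_add.
    apply: leq_trans h; apply: subset_leq_card; apply/subsetP => v.
    by rewrite in_setI !in_set.
  by apply: subset_leq_card; apply/subsetP => v; rewrite in_setD !in_set andbC.
apply: subset_leq_card; apply/subsetP => -[u v]; rewrite !in_set /=.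
by case/and3P => /andP[_ ->] -> ->.
Qed.

(** The cross product is nonzero and isotropic, and gives a line over F fixed by u. The eigenvalues
    of u are then in F and distinct, so a unipotent t clears the entry above the diagonal. *)
Lemma diagonalise u v : u \in SL -> v \in SL -> tr u ^+ 2 != 4 -> delta u v = 0 ->
  v \notin 'C[u]%g -> exists2 c, c \in SL & ec (u ^ c)%g = 0 /\ eb (u ^ c)%g = 0.
Proof.
move=> uS vS u4 d0; rewrite cent1_phi => D0.
have [c cS hc] := isotropic_conj D0 d0.
have uc : ec (u ^ c)%g = 0.
  by apply: hc; rewrite /dot /cross /=; ring.
have ucS : (u ^ c)%g \in SL by rewrite groupJ.
have n0 : ea (u ^ c)%g - ed (u ^ c)%g != 0 by apply: upper_neq; rewrite ?trJ.
move: n0 uc ucS; rewrite -/(u ^ c)%g; move Ew : (u ^ c)%g => w n0 wc wS.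
have [t [tS ta tb tc td]] : exists t, [/\ t \in SL, ea t = 1, eb t = - eb w / (ea w - ed w),
    ec t = 0 & ed t = 1 :> F] by apply: SL_ex; ring.
exists (c * t)%g; rewrite ?groupM // conjgM Ew conjgE !entM !entV // ?ta ?tb ?tc ?td wc.
by split; [ring | field].
Qed.

Variable A : {set GL2 F}.
Hypothesis genA : <<A>>%g = SL.

(* If x = 1 fails, half of S shares a fixed point with one of its elements, so a
   quarter of S has a common fixed point, which some generator moves. *)
Lemma good_pairs (S : {set GL2 F}) (s : F) : s ^+ 2 != 4 -> (48 <= #|S|)%N ->
  {in S, forall u, u \in SL /\ tr u = s} ->
  exists2 x, x \in 1%g |: A & (#|S| ^ 2 <=
    32 * #|[set p : GL2 F * GL2 F | [&& p.1 \in S, p.2 \in S & delta p.1 (p.2 ^ x)%g != 0%R]]|)%N.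
Proof.
move=> s4 S48 hS.
pose bad u := [set v in S | delta u v == 0].
have [/forall_inP few|/forall_inPn[u uS]] := boolP [forall u in S, 2 * #|bad u| <= #|S|]%N.
  exists 1%g; first exact: setU11.
  have h u : u \in S -> (#|S| - #|S| ./2 <= #|[set v in S | delta u (v ^ 1)%g != 0%R]|)%N.
    move=> uS; rewrite leq_subLR -[X in (X <= _)%N](cardsID (bad u) S) leq_add //.
      rewrite (setIidPr _); last by apply/subsetP => v; rewrite in_set => /andP[].
      by rewrite geq_half_double -mul2n; exact: few.
    apply: subset_leq_card; apply/subsetP => v; rewrite in_setD !in_set conjg1.
    by case/andP => /nandP[/negPf->|->] // ->.
  have hP := card_ge_pairs (B := S) h.
  apply: (@leq_trans (32 * ((#|S| - #|S| ./2) * #|S|))); last by rewrite leq_mul2l hP orbT.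
  rewrite -mulnn mulnA leq_mul2r; apply/orP; right; move: (#|S|) => n.
  have : (n./2.*2 <= n)%N by rewrite -[leqRHS](odd_double_half n) leq_addl.
  by move: n./2 => k; lia.
rewrite -ltnNge => many; have [uSL tu] := hS u uS.
have u4 : tr u ^+ 2 != 4 by rewrite tu.
(* [bad u] has more than 24 elements, but only two elements of trace s commute with u. *)
have [v vbad vC] : exists2 v, v \in bad u & v \notin 'C[u]%g.
  apply/exists_inP; apply: contraT => /exists_inPn all.
  have : (#|bad u| <= 2)%N.
    apply: leq_trans (card_cent_tr two0 s uSL u4); apply: subset_leq_card; apply/subsetP => v vb.
    have := all v vb; rewrite negbK => vC; move: vb; rewrite in_set => /andP[/hS[vSL tv] _].
    by rewrite in_set in_setI vSL vC tv eqxx.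
  rewrite leqNgt => /negP[]; rewrite -(ltn_pmul2l (isT : 0 < 2)%N).
  by apply: leq_ltn_trans many; apply: leq_trans S48.
move: vbad; rewrite in_set => /andP[/hS[vSL tv] /eqP d0].
have [c cS [uc ub]] := diagonalise uSL vSL u4 d0 vC.
have ucS : (u ^ c)%g \in SL by rewrite groupJ.
have n0 : ea (u ^ c)%g - ed (u ^ c)%g != 0 by apply: upper_neq; rewrite ?trJ.
(* With u diagonal, delta is minus a nonzero square times the product bc of the off-diagonal
   entries: each element of [bad u] fixes one of the two axes. *)
have upper_or_lower v' : v' \in bad u -> ec (v' ^ c)%g = 0 \/ eb (v' ^ c)%g = 0.
  rewrite in_set => /andP[/hS[vS _]]; rewrite -(deltaJ uSL vS cS).
  rewrite /delta /qf /cross /phi /= uc ub => /eqP h.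
  have : (ea (u ^ c)%g - ed (u ^ c)%g) ^+ 2 * (ec (v' ^ c)%g * eb (v' ^ c)%g) = 0.
    by apply: (lincomb1 (k := - 1) h); ring.
  move/eqP; rewrite mulf_eq0 (mulf_eq0 (ec _)) expf_eq0 /= (negPf n0) /=.
  by case/orP => /eqP; [left | right].
have [c' c'S quarter] : exists2 c', c' \in SL &
    (#|S| <= 4 * #|[set v' in S | ec (v' ^ c')%g == 0%R]|)%N.
  (* w exchanges the two axes, so either half of [bad u] can be made upper triangular. *)
  have [w [wS wa wb wc wd]] : exists w, [/\ w \in SL, ea w = 0, eb w = - 1, ec w = 1 & ed w = 0 :> F].
    by apply: SL_ex; ring.
  have ecw u' : ec (u' ^ w)%g = - eb u'.
    by rewrite conjgE !entM !entV // ?wa ?wb ?wc ?wd; ring.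
  have : (#|bad u| <= #|[set v' in S | ec (v' ^ c)%g == 0%R]| +
                      #|[set v' in S | ec (v' ^ (c * w))%g == 0%R]|)%N.
    rewrite -cardsUI; apply: leq_trans (leq_addr _ _); apply: subset_leq_card.
    apply/subsetP => v' vb; have := upper_or_lower v' vb; move: vb; rewrite in_setU !in_set => /andP[-> _] /=.
    case=> [->|e]; first by rewrite eqxx.
    by rewrite conjgM ecw e oppr0 eqxx orbT.
  move=> h; case: (leqP (#|S|) (4 * #|[set v' in S | ec (v' ^ c)%g == 0%R]|)) => h1.
    by exists c.
  exists (c * w)%g; rewrite ?groupM //.
  exact: more_than_quarter many h h1.
have [x xA xc] := gen_moves genA c'S.
have xS : x \in SL by rewrite -genA mem_gen.
exists x; first by rewrite in_setU xA orbT.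
set S' := [set v' in S | ec (v' ^ c')%g == 0%R] in quarter.
have := upper_pairs c'S xS (S := S') (s := s) _ s4 xc.
have hS' : {in S', forall u, [/\ u \in SL, tr u = s & ec (u ^ c')%g = 0]}.
  by move=> v'; rewrite in_set => /andP[/hS[-> ->] /eqP ->].
move=> /(_ hS') h.
apply: (@leq_trans (32 * ((#|S'| - 4) * (#|S'| - 2)))).
  exact: quarter_pairs.
rewrite leq_mul2l; apply: leq_trans h _; apply: subset_leq_card; apply/subsetP => p.
by rewrite !in_set => /and3P[/andP[-> _] /andP[-> _] ->].
Qed.

End GoodPairs.

Lemma cube_bound (n P M : nat) : (48 <= n)%N -> (n ^ 2 <= 32 * P)%N ->
  ((n - 2) * P <= 2 * (M * M))%N -> (n ^ 3 <= 128 * M ^ 2)%N.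
Proof.
move=> n48 h1 h2; apply: (@leq_trans ((2 * (n - 2)) * (32 * P))).
  by rewrite expnS leq_mul //; lia.
have -> : (2 * (n - 2) * (32 * P) = 64 * ((n - 2) * P))%N by rewrite mulnACA.
apply: leq_trans (leq_mul (leqnn 64) h2) _.
by rewrite mulnA -mulnn.
Qed.

Section Growth.
Variable F : finFieldType.
Implicit Types u v w g x : GL2 F.
Local Notation SL := (SL2 F).
Hypothesis two0 : (2 : F) != 0.
Hypothesis three0 : (3 : F) != 0.
Variable A : {set GL2 F}.
Hypothesis genA : <<A>>%g = SL.
Hypothesis symA : (A^-1)%g = A.
Local Notation B := (1%g |: A).

(** Two elements of B^m giving the same conjugate of h differ by an element of B^(2m) centralising
    h: a poor torus means many conjugates. *)
Lemma card_class (D : {set GL2 F}) m h : D = (B ^+ m)%g ->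
  (#|D| <= #|(B ^+ (m + m) :&: 'C_SL[h])%g| * #|[set (h ^ x)%g | x in D]|)%N.
Proof.
move=> ->; apply: (card_fibers (f := fun x => (h ^ x)%g)) => [x xB | z _].
  exact: imset_f.
have [->|[x0]] := set_0Vmem [set x in (B ^+ m)%g | (h ^ x)%g == z]; first by rewrite cards0.
rewrite in_set => /andP[x0B /eqP e0].
rewrite -[X in (X <= _)%N](card_imset _ (mulIg x0^-1%g)); apply: subset_leq_card; apply/subsetP => _ /imsetP[x + ->].
rewrite in_set => /andP[xB /eqP e].
have xxB : (x * x0^-1)%g \in (B ^+ (m + m))%g.
  by apply: mem_expM => //; apply: memV_exp x0B; apply: ballV.
rewrite in_setI xxB in_setI (subsetP (ball_SL genA (m + m))) //=.
have E : (h ^ (x * x0^-1) = h)%g by rewrite conjgM e -e0 conjgK.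
by apply/cent1P; rewrite /commute [RHS]conjgC E.
Qed.

Lemma ball_growth m rho : (4 <= m)%N -> (7 <= rho)%N ->
  (#|(B ^+ m)%g| ^ 3 <= 48 ^ 3 * (rho ^ 3 * #|(B ^+ (8 * m + 6))%g| ^ 2))%N \/
  ((rho - 6) * #|SL| <= 4 * #|F| * #|(B ^+ (m + m))%g|)%N.
Proof.
move=> m4 rho7; have mm7 : (7 <= m + m)%N by rewrite (leq_trans (isT : 7 <= 4 + 4)%N) ?leq_add.
have [[h [hB hr hC]]|] := poor_torus_or_quadratic two0 three0 genA symA mm7 rho7; [left | by right].
have BSL k x : x \in (B ^+ k)%g -> x \in SL by apply: subsetP (ball_SL genA k) _.
have hS : h \in SL := BSL _ _ hB.
pose S := [set (h ^ x)%g | x in (B ^+ m)%g].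
have SB u : u \in S -> u \in (B ^+ (m + (m + m + 2) + m))%g.
  by move=> /imsetP[x xB ->]; apply: ball_conj.
have Str : {in S, forall u, u \in SL /\ tr u = tr h}.
  by move=> u uS; split; [exact: BSL (SB u uS) | case/imsetP: uS => x _ ->; rewrite trJ].
have cardS : (#|(B ^+ m)%g| <= rho * #|S|)%N.
  by apply: leq_trans (card_class h (erefl _)) _; rewrite leq_mul2r (ltnW hC) orbT.
set M := #|(B ^+ (8 * m + 6))%g|.
suff S3 : (#|S| ^ 3 <= 48 ^ 3 * M ^ 2)%N.
  apply: (@leq_trans ((rho * #|S|) ^ 3)); first by rewrite leq_exp2r.
  by rewrite expnMn mulnCA leq_mul2l S3 orbT.
have M1 : (0 < M)%N.
  apply/card_gt0P; exists 1%g; apply: subsetP (expg_sub (ball1 A) (leq0n _)) _ _.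
  by rewrite expg0 set11.
(* For fewer than 48 conjugates the constant 48^3 alone gives the bound. *)
have [S48|S48] := leqP 48 #|S|; last first.
  apply: (@leq_trans (48 ^ 3)); first by rewrite leq_exp2r // ltnW.
  by rewrite leq_pmulr // expn_gt0 M1.
have [t0 t4] := andP hr.
have [x xB pairs] := good_pairs two0 genA t4 S48 Str.
have xS : x \in SL by apply: (BSL 1%N).
have Bout k : (k <= 8 * m + 6)%N -> (B ^+ k)%g \subset (B ^+ (8 * m + 6))%g.
  exact: expg_sub (ball1 A).
(* Elements of S have length 4 m + 2, and conjugating one of two by x adds 2 to their quotient: 8 m
   + 6 in all. *)
have le1 : (m + (m + m + 2) + m + (1 + (m + (m + m + 2) + m) + 1) <= 8 * m + 6)%N by clear; lia.
have le2 : (m + (m + m + 2) + m + (m + (m + m + 2) + m) <= 8 * m + 6)%N by clear; lia.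
have SV u : u \in S -> (u^-1)%g \in (B ^+ (m + (m + m + 2) + m))%g.
  by move=> /SB; apply: memV_exp; apply: ballV.
have StrJ : {in (S :^ x)%g, forall u, u \in SL /\ tr u = tr h}.
  by move=> _ /imsetP[u /Str[uS tu] ->]; rewrite groupJ ?trJ.
have hM1 : {in S & (S :^ x)%g, forall u v, (u^-1 * v)%g \in (B ^+ (8 * m + 6))%g}.
  move=> u _ uS /imsetP[v vS ->]; apply: (subsetP (Bout _ le1)).
  by apply: mem_expM; [exact: SV | apply: ball_conj => //; exact: SB].
have hM2 : {in S & S, forall u v, (u^-1 * v)%g \in (B ^+ (8 * m + 6))%g}.
  move=> u v uS vS; apply: (subsetP (Bout _ le2)).
  by apply: mem_expM; [exact: SV | exact: SB].
have := triple_count t0 Str StrJ Str hM1 hM2; rewrite -/M.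
set P := #|[set _ | _]| => hP.
have PP : (#|[set p : GL2 F * GL2 F | [&& p.1 \in S, p.2 \in S & delta p.1 (p.2 ^ x)%g != 0%R]]| <= P)%N.
  have inj : injective (fun p : GL2 F * GL2 F => (p.1, p.2 ^ x)%g).
    by move=> [a b] [a' b'] E; rewrite (congr1 fst E : a = a') (conjg_inj x (congr1 snd E) : b = b').
  rewrite -(card_imset _ inj); apply: subset_leq_card; apply/subsetP => _ /imsetP[[u v] + ->].
  by rewrite !in_set /= => /and3P[-> vS ->]; rewrite memJ_conjg vS.
apply: leq_trans (_ : 128 * M ^ 2 <= _)%N; last first.
  by rewrite leq_mul2r; apply/orP; right; apply: (@leq_trans (48 ^ 2)%N); rewrite ?leq_pexp2l.
apply: (cube_bound S48 _ hP); apply: leq_trans pairs _.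
by rewrite leq_mul2l PP orbT.
Qed.

End Growth.

(** * From |F|^2 to the whole group *)

Section Cover.
Variable gT : finGroupType.
Implicit Types B : {set gT}.
Local Open Scope group_scope.

(* While the powers of B grow, some translate of B is disjoint from B^n inside B^(n+3). *)
Lemma gen_sub_expg B k : 1 \in B -> B^-1 = B -> (#|<<B>>| <= k * #|B|)%N -> <<B>> \subset B ^+ (3 * k + 1).
Proof.
move=> B1 BV hk.
have step j : <<B>> \subset B ^+ (3 * j + 1) \/ (j.+1 * #|B| <= #|B ^+ (3 * j + 1)|)%N.
  elim: j => [|j [h|h]]; first by right; rewrite expg1 mul1n.
    by left; apply: subset_trans h _; apply: expg_sub B1 _; rewrite leq_add2r leq_mul2l leqnSn orbT.
  rewrite mulnSr -addnA (addnC 3) addnA; set n := (3 * j + 1)%N in h *.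
  have [sub|/subsetPn[g gB gN]] := boolP (B ^+ n.+2 \subset B ^+ n.+1).
    left; apply: subset_trans (expg_sub (m := n.+1) B1 _); last by rewrite addn3 ltnW.
    apply/subsetP => x /(gen_expg B1 BV)[k' ]; elim: k' x => [|k' IH] x.
      by rewrite expg0 => /set1P->; apply: subsetP (expg_sub (m := 0) B1 _) _ _; rewrite ?expg0 ?set11.
    rewrite expgSr => /mulsgP[y b /IH yB bB ->]; apply: (subsetP sub).
    by rewrite expgSr mem_mulg.
  right; apply: (@leq_trans #|(g *: B) :|: B ^+ n|).
    rewrite cardsU disjoint_setI0 ?cards0 ?subn0; last first.
      rewrite -setI_eq0; apply/eqP/setP => x; rewrite in_setI in_set0; apply/negP => /andP[].
      case/lcosetP=> b bB ->{x} gb; case/negP: gN.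
      by rewrite -(mulgK b g) expgSr mem_mulg // -BV mem_invg invgK.
    by rewrite card_lcoset mulSn leq_add2l.
  apply: subset_leq_card; rewrite subUset expg_sub // ?leq_addr // andbT.
  apply/subsetP => _ /lcosetP[b bB ->].
  by rewrite addn3 expgSr mem_mulg.
have [//|h] := step k.
have := leq_trans h (leq_trans (subset_leq_card (expg_gen_sub B _)) hk).
by rewrite leq_mul2r ltnn orbF cards_eq0 => /eqP B0; rewrite B0 in_set0 in B1.
Qed.

End Cover.

Lemma energy_arith (l q N : nat) : (0 < q)%N -> (0 < N)%N ->
  (l * (q.+1 * N ^ 2) <= 2 * (q ^ 3 * N))%N -> (N * l < 2 * q ^ 2)%N.
Proof.
move=> q0 N0 h; rewrite ltnNge; apply/negP => h2.
have : (2 * q ^ 2 * q.+1 <= 2 * q ^ 3)%N.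
  rewrite -(leq_pmul2r N0) -[leqRHS]mulnA; apply: leq_trans h.
  rewrite mulnC mulnA -mulnn [leqRHS]mulnCA; nia.
by rewrite -mulnA leq_mul2l /= mulnS [(q ^ 3)%N]expnSr -[leqRHS]add0n leq_add2r leqNgt expn_gt0 q0.
Qed.

(** * Sums of a set with its dilates *)

Section Energy.
Variable F : finFieldType.
Implicit Types (X L : {set F}).

Definition dilate_sum X (m : F) : {set F} := [set x + m * y | x in X, y in X].

(* On average over all dilations m, the second moment of the number of
   representations s = x + m y is that of the uniform distribution plus a
   diagonal term. *)
Lemma dilate_sum_large X L : (2 * #|F| ^ 2 <= #|X| ^ 2 * #|L|)%N ->
  exists2 m, m \in L & (#|F| <= 2 * #|dilate_sum X m|)%N.
Proof.
move=> big; apply/exists_inP; apply: contraLR big => /exists_inPn small.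
have {}small m : m \in L -> (2 * #|dilate_sum X m| < #|F|)%N by move/small; rewrite -ltnNge.
rewrite -ltnNge.
set q := #|F| in small *; set n := #|X|.
have q0 : (0 < q)%N by rewrite /q (cardD1 0).
have [L0|[m0 m0L]] := set_0Vmem L; first by rewrite L0 cards0 muln0 muln_gt0 expn_gt0 q0.
have [X0|X0] := posnP n; first by rewrite X0 mul0n muln_gt0 expn_gt0 q0.
pose P := setX X X.
have cP : #|P| = (n ^ 2)%N by rewrite cardsX mulnn.
pose r m s : int := \sum_(p in P) ((p.1 + m * p.2 == s) : nat)%:Z.
have delta1 (a : F) : \sum_s ((a == s) : nat)%:Z = 1.
  by rewrite (bigD1 a) //= eqxx big1 ?addr0 // => s; rewrite eq_sym => /negPf->.
have r1 m : \sum_s r m s = (n ^ 2)%:Z.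
  rewrite exchange_big /= (eq_bigr (fun=> 1)); last by move=> p _; exact: delta1.
  by rewrite sumr_const cP natz.
have r2 m : \sum_s r m s ^+ 2 =
    \sum_(p in P) \sum_(p' in P) ((p.1 + m * p.2 == p'.1 + m * p'.2) : nat)%:Z.
  transitivity (\sum_s \sum_(p in P) \sum_(p' in P)
    ((p.1 + m * p.2 == s) : nat)%:Z * ((p'.1 + m * p'.2 == s) : nat)%:Z).
    by apply: eq_bigr => s _; rewrite expr2 big_distrlr.
  rewrite exchange_big; apply: eq_bigr => p _; rewrite exchange_big; apply: eq_bigr => p' _ /=.
  rewrite (bigD1 (p.1 + m * p.2)) //= eqxx mul1r eq_sym big1 ?addr0 // => s.
  by rewrite eq_sym => /negPf->; rewrite mul0r.
have energy : \sum_m \sum_s r m s ^+ 2 <= (q * n ^ 2 + n ^ 2 * n ^ 2)%:Z.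
  rewrite (eq_bigr _ (fun m _ => r2 m)) exchange_big /=.
  apply: (@le_trans _ _ (\sum_(p in P) (q + n ^ 2)%:Z)); last first.
    by rewrite sumr_const cP -mulr_natr natz -PoszM mulnDl.
  apply: ler_sum => p pP; rewrite exchange_big /=.
  apply: (@le_trans _ _ (\sum_(p' in P) ((p' == p) * q + 1)%:Z)).
    apply: ler_sum => p' _; have [->|pp'] := eqVneq p' p.
      rewrite mul1n (eq_bigr (fun=> 1)); last by move=> m _; rewrite eqxx.
      by rewrite sumr_const natz -/q; lia.
    (* Two different pairs agree for at most one dilation m, the root of a linear equation. *)
    rewrite mul0n add0n; have [e2|n2] := eqVneq p'.2 p.2.
      rewrite big1 // => m _; rewrite e2 (inj_eq (addIr _)) [p.1 == _]eq_sym.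
      by case: eqP => // e1; case/eqP: pp'; case: p p' {pP} e1 e2 => [a b] [a' b'] /= -> ->.
    rewrite (bigD1 ((p.1 - p'.1) / (p'.2 - p.2))) //= big1 => [|m mN].
      by case: (_ == _).
    case: eqP => // e; case/eqP: mN; rewrite -subr_eq0 in n2; apply: (mulIf n2).
    by rewrite divfK //; apply: (lincomb1 (k := - 1) e); ring.
  rewrite (eq_bigr (fun p' => ((p' == p) * q)%:Z + 1)) // big_split /= sumr_const cP natz.
  rewrite (bigD1 p) //= eqxx mul1n big1 ?addr0 ?PoszD // => p' /andP[_ /negPf->].
  by rewrite mul0n.
(* This is q^2 times the sum of squared deviations of [r m] from its mean n^2 / q, kept free of
   denominators. *)
pose V m := \sum_s (q%:Z * r m s - (n ^ 2)%:Z) ^+ 2.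
have VE m : V m = q%:Z ^+ 2 * (\sum_s r m s ^+ 2) - q%:Z * (n ^ 2)%:Z ^+ 2.
  rewrite /V (eq_bigr (fun s => q%:Z ^+ 2 * r m s ^+ 2 + (- 2 * q%:Z * (n ^ 2)%:Z * r m s + (n ^ 2)%:Z ^+ 2))).
    rewrite big_split /= -mulr_sumr big_split /= -mulr_sumr r1 sumr_const -[#|_|]/q -mulr_natr natz; ring.
  by move=> s _; ring.
have V0 m : 0 <= V m by apply: sumr_ge0 => s _; exact: sqr_ge0.
(* More than half of the s are not represented, and each contributes n^4 to V. *)
have Vsmall m : m \in L -> q.+1%:Z * (n ^ 2)%:Z ^+ 2 <= 2 * V m.
  move=> mL; have cY := small m mL; set Y := dilate_sum X m in cY.
  have : \sum_(s in ~: Y) (n ^ 2)%:Z ^+ 2 <= V m.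
    rewrite /V [leRHS](bigID (mem (~: Y))) /= -[leLHS]addr0; apply: lerD.
      apply: ler_sum => s; rewrite in_setC => sY.
      rewrite (_ : r m s = 0) ?mulr0 ?sub0r ?sqrrN // /r big1 // => -[x y] /=.
      rewrite in_setX => /andP[xX yX]; case: eqP => // e; case/negP: sY; rewrite -e.
      exact: imset2_f.
    by apply: sumr_ge0 => s _; exact: sqr_ge0.
  rewrite sumr_const -[leLHS]mulr_natl natz => h.
  apply: le_trans (ler_wpM2l (isT : 0 <= 2 :> int) h); rewrite [leRHS]mulrA; apply: ler_wpM2r.
    exact: sqr_ge0.
  have := cardsC Y; rewrite -/q; lia.
have total : \sum_(m in L) q.+1%:Z * (n ^ 2)%:Z ^+ 2 <= 2 * (q%:Z ^+ 3 * (n ^ 2)%:Z).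
  apply: le_trans (ler_sum _ Vsmall) _; rewrite -mulr_sumr; apply: ler_wpM2l => //.
  apply: (@le_trans _ _ (\sum_m V m)).
    by rewrite [leRHS](bigID (mem L)) /= lerDl sumr_ge0.
  rewrite (eq_bigr _ (fun m _ => VE m)) sumrB -mulr_sumr sumr_const -[#|_|]/q -[X in _ - X <= _]mulr_natl natz.
  have := ler_wpM2l (sqr_ge0 q%:Z) energy; rewrite PoszD !PoszM => h.
  rewrite lerBlDr; apply: le_trans h _.
  by rewrite le_eqVlt; apply/orP; left; apply/eqP; ring.
rewrite sumr_const -[leLHS]mulr_natl natz in total.
have {total} : (#|L| * (q.+1 * (n ^ 2) ^ 2) <= 2 * (q ^ 3 * n ^ 2))%N.
  have pX a k : a%:Z ^+ k = (a ^ k)%N%:Z by rewrite -[RHS]natz natrX natz.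
  by move: total; rewrite !pX (natz 2) -!PoszM lez_nat.
by apply: energy_arith; rewrite // expn_gt0 X0.
Qed.

End Energy.

(** Origin of the exponent 8/3: X >= M / q^2 and K >= M / (4 q^2) give X^2 K >= M^3 / (4 q^6), which
    has to reach 2 q^2. *)
Lemma root_pieces_arith (q M X L K : nat) : (0 < q)%N -> (M <= X * q ^ 2)%N -> (M <= L * q * q.+1)%N ->
  (L <= 2 * K)%N -> (8 * q ^ 8 <= M ^ 3)%N -> (2 * q ^ 2 <= X ^ 2 * K)%N.
Proof.
move=> q0 hX hL hK hM.
have h4 : (M <= 4 * K * q ^ 2)%N.
  apply: leq_trans hL _; rewrite -mulnA; apply: leq_trans (leq_mul hK (leqnn _)) _.
  by rewrite -mulnn; nia.
have q6 : (0 < 4 * q ^ 6)%N by rewrite muln_gt0 expn_gt0 q0.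
rewrite -(leq_pmul2l q6).
have -> : (4 * q ^ 6 * (2 * q ^ 2) = 8 * q ^ 8)%N by rewrite mulnACA -expnD.
apply: leq_trans hM _.
have -> : (4 * q ^ 6 * (X ^ 2 * K) = (X * q ^ 2) * (X * q ^ 2) * (4 * K * q ^ 2))%N.
  by rewrite (expnD q 2 4) (expnD q 2 2) -!mulnn; lia.
by rewrite expnSr -mulnn !leq_mul.
Qed.

Lemma triple_arith (q V M : nat) : (4 <= q)%N -> (q <= 2 * V)%N -> (V * (V - 1) * V <= M)%N ->
  (q ^ 3 <= 16 * M)%N.
Proof.
move=> q4 hV hM; apply: leq_trans (_ : 16 * (V * (V - 1) * V) <= _)%N; last by rewrite leq_mul2l hM orbT.
have h1 : (q <= 4 * (V - 1))%N by lia.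
apply: (@leq_trans ((2 * V) * (4 * (V - 1)) * (2 * V))); last by lia.
by rewrite expnSr -mulnn !leq_mul.
Qed.

(** * Unipotent elements in large balls *)

Section Ending.
Variable F : finFieldType.
Implicit Types u v w g x : GL2 F.
Local Notation SL := (SL2 F).
Variable A : {set GL2 F}.
Hypothesis genA : <<A>>%g = SL.
Hypothesis symA : (A^-1)%g = A.
Local Notation B := (1%g |: A).

Definition upper_unip u := [&& ea u == 1, ec u == 0 & ed u == 1].
Definition unip_coord k : {set F} := [set eb u | u in (B ^+ k)%g & upper_unip u].

Definition diag_coord k : {set F} := [set ea u | u in (B ^+ k)%g & ec u == 0].

Lemma unip_inj u v : upper_unip u -> upper_unip v -> eb u = eb v -> u = v.
Proof.
move=> /and3P[/eqP ha /eqP hc /eqP hd] /and3P[/eqP ha' /eqP hc' /eqP hd'] hb.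
by apply: ent_eq; rewrite ?ha ?hc ?hd.
Qed.

Lemma memB_SL k u : u \in (B ^+ k)%g -> u \in SL.
Proof. exact: subsetP (ball_SL genA k) u. Qed.

Lemma memB_V k u : u \in (B ^+ k)%g -> (u^-1)%g \in (B ^+ k)%g.
Proof. by apply: memV_exp; apply: ballV. Qed.

(** Elements with the same first column differ by an upper unipotent one. *)
Lemma unip_coord_ge n : (#|(B ^+ n)%g| <= #|unip_coord (n + n)| * #|F| ^ 2)%N.
Proof.
have -> : (#|F| ^ 2)%N = #|[set: F * F]| by rewrite cardsT card_prod mulnn.
apply: (card_fibers (f := fun u => (ea u, ec u))) => // [[a c] _].
have [->|[u0]] := set_0Vmem [set u in (B ^+ n)%g | (ea u, ec u) == (a, c)]; first by rewrite cards0.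
rewrite in_set => /andP[u0B /eqP[ea0 ec0]]; have u0S := memB_SL u0B; have d0 := SLE u0S.
have unip u : u \in [set u in (B ^+ n)%g | (ea u, ec u) == (a, c)] ->
    (u0^-1 * u)%g \in (B ^+ (n + n))%g /\ upper_unip (u0^-1 * u)%g.
  rewrite in_set => /andP[uB /eqP[eau ecu]]; split; first by rewrite mem_expM // memB_V.
  have d := SLE (memB_SL uB); rewrite eau ecu in d; rewrite ea0 ec0 in d0.
  rewrite /upper_unip !entM !entV // ea0 ec0 eau ecu; apply/and3P; split; apply/eqP.
  - by apply: (lincomb1 (k := 1) d0); ring.
  - by ring.
  - by apply: (lincomb1 (k := 1) d); ring.
rewrite -(card_in_imset (f := fun u => eb (u0^-1 * u)%g)).
  apply: subset_leq_card; apply/subsetP => _ /imsetP[u /unip[h1 h2] ->].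
  by apply/imsetP; exists (u0^-1 * u)%g; rewrite ?inE ?h1.
by move=> u v /unip[_ hu] /unip[_ hv] e; apply: (mulgI u0^-1%g); apply: unip_inj.
Qed.

(** Elements whose first columns agree as points of the projective line, encoded in [option F],
    differ by an upper triangular one, which its entries a and b determine. *)
Lemma diag_coord_ge n : (#|(B ^+ n)%g| <= #|diag_coord (n + n)| * #|F| * #|F|.+1)%N.
Proof.
have -> : #|F|.+1 = #|[set: option F]| by rewrite cardsT card_option.
apply: (card_fibers (f := fun u => if ea u == 0 then None else Some (ec u / ea u))) => // o _.
set D := [set _ in _ | _]; have [->|[u0]] := set_0Vmem D; first by rewrite cards0.
rewrite in_set => /andP[u0B /eqP f0]; have u0S := memB_SL u0B.
have upper u : u \in D -> (u0^-1 * u)%g \in (B ^+ (n + n))%g /\ ec (u0^-1 * u)%g = 0.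
  rewrite in_set => /andP[uB /eqP fu]; split; first by rewrite mem_expM // memB_V.
  rewrite !entM !entV //; move: fu; rewrite -f0.
  case: eqP => [-> | /eqP n1]; case: eqP => [-> | /eqP n2] //; first by rewrite mulr0 mul0r addr0.
  case=> e; apply: (mulfI n1); apply: (mulfI n2).
  have {}e : ec u * ea u0 = ec u0 * ea u.
    by rewrite -[ec u](divfK n1) e mulrAC divfK.
  by apply: (lincomb1 (k := ea u * ea u0) e); ring.
have -> : (#|diag_coord (n + n)| * #|F|)%N = #|setX (diag_coord (n + n)) [set: F]|.
  by rewrite cardsX cardsT.
rewrite -(card_in_imset (f := fun u => (ea (u0^-1 * u)%g, eb (u0^-1 * u)%g))).
  apply: subset_leq_card; apply/subsetP => _ /imsetP[u /upper[h1 h2] ->].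
  by rewrite in_setX in_setT andbT; apply/imsetP; exists (u0^-1 * u)%g; rewrite ?in_set ?h1 ?h2 ?eqxx.
move=> u v /upper[hu cu] /upper[hv cv] [e1 e2]; apply: (mulgI u0^-1%g).
have hu1 := SLE (memB_SL hu); have hv1 := SLE (memB_SL hv).
move: (u0^-1 * u)%g (u0^-1 * v)%g cu cv e1 e2 hu1 hv1 => {hu hv}u {}v cu cv e1 e2.
rewrite cu cv !mulr0 !subr0 => hu hv; apply: ent_eq; rewrite ?cu ?cv //.
have a0 : ea u != 0 by apply/eqP => a0; move/eqP: hu; rewrite a0 mul0r eq_sym oner_eq0.
by apply: (mulfI a0); rewrite hu e1 hv.
Qed.

(** Conjugation by an upper triangular element with diagonal entries l, 1/l multiplies the unipotent
    coordinate by l^2. *)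
Lemma dilate_unip n l : l \in diag_coord n ->
  dilate_sum (unip_coord n) (l ^+ 2) \subset unip_coord (n + (n + n + n)).
Proof.
case/imsetP=> k; rewrite inE => /andP[kB /eqP ck] ->.
apply/subsetP => _ /imset2P[_ _ /imsetP[u + ->] /imsetP[v + ->] ->].
rewrite !inE => /andP[uB /and3P[/eqP ua /eqP uc /eqP ud]] /andP[vB /and3P[/eqP va /eqP vc /eqP vd]].
have kS := memB_SL kB; have dk := SLE kS; rewrite ck mulr0 subr0 in dk.
have wE : [/\ ea (k * v * k^-1)%g = 1, eb (k * v * k^-1)%g = ea k ^+ 2 * eb v,
    ec (k * v * k^-1)%g = 0 & ed (k * v * k^-1)%g = 1].
  rewrite !entM !entV // va vc vd ck; split; last 1 first.
  - by apply: (lincomb1 (k := 1) dk); ring.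
  - by apply: (lincomb1 (k := 1) dk); ring.
  - by ring.
  - by ring.
have wB : (k * v * k^-1)%g \in (B ^+ (n + n + n))%g by rewrite !mem_expM // memB_V.
move: (k * v * k^-1)%g wB wE => w wB [wa wb wc wd].
apply/imsetP; exists (u * w)%g; last by rewrite !entM ua wb wd; ring.
rewrite inE mem_expM //= /upper_unip !entM ua uc ud wa wc wd.
by rewrite !mulr0 !mul0r !mul1r !addr0 add0r !eqxx.
Qed.

(** As in the big Bruhat cell, (u, v, w) is recovered from u (c v c) w, for a generator c that is
    not upper triangular: [ec] gives v, then [ea] and [ed] give u and w. At most one v makes c v c
    upper triangular. *)
Lemma unip_triple n : let V := #|unip_coord n| in
  (V * (V - 1) * V <= #|(B ^+ (n + 1 + n + 1 + n))%g|)%N.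
Proof.
pose U := [set u in (B ^+ n)%g | upper_unip u].
have -> : #|unip_coord n| = #|U|.
  rewrite -(card_in_imset (f := @eb F) (D := U)).
    by congr #|_|; apply: eq_imset.
  by move=> u v; rewrite !inE => /andP[_ hu] /andP[_ hv]; apply: unip_inj.
have [c cA] := gen_moves genA (group1 SL); rewrite conjg1 => c0.
pose U' := [set v in U | ec (c * v * c)%g != 0].
have ecE v : upper_unip v -> ec (c * v * c)%g = ec c * (ea c + ed c + ec c * eb v).
  by case/and3P => /eqP va /eqP vc /eqP vd; rewrite !entM va vc vd; ring.
have U'1 : (#|U| - 1 <= #|U'|)%N.
  rewrite leq_subLR addnC -(cardsID [set v | ec (c * v * c)%g != 0] U) leq_add //.
    by apply: subset_leq_card; apply/subsetP => v; rewrite !inE.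
  apply/card_le1_eqP => u v; rewrite !in_setD !in_set !negbK.
  move=> /andP[/eqP hu /andP[_ uU]] /andP[/eqP hv /andP[_ vU]].
  apply: unip_inj => //; apply: (mulfI c0); apply: (mulfI c0).
  by rewrite !ecE // in hu hv; apply: (lincomb2 (k := 1) (k' := - 1) hv hu); ring.
apply: (@leq_trans #|setX (setX U U') U|); first by rewrite !cardsX !leq_mul.
rewrite -(card_in_imset (f := fun p => (p.1.1 * (c * p.1.2 * c) * p.2)%g)).
  apply: subset_leq_card; apply/subsetP => _ /imsetP[[[u v] w] /= + ->].
  rewrite !in_setX !in_set => /andP[/andP[/andP[uB _] /andP[/andP[vB _] _]] /andP[wB _]].
  have cB : c \in (B ^+ 1)%g by rewrite expg1 in_setU cA orbT.
  by rewrite !mulgA !mem_expM.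
have prodE u g w : upper_unip u -> upper_unip w ->
    [/\ ec (u * g * w)%g = ec g, ea (u * g * w)%g = ea g + eb u * ec g
      & ed (u * g * w)%g = ec g * eb w + ed g].
  move=> /and3P[/eqP ua /eqP uc /eqP ud] /and3P[/eqP wa /eqP wc /eqP wd].
  by rewrite !entM ua uc ud wa wc wd; split; ring.
move=> [[u v] w] [[u' v'] w'] /=; rewrite !in_setX !in_set /=.
move=> /andP[/andP[/andP[_ uU] /andP[/andP[_ vU] g0]] /andP[_ wU]].
move=> /andP[/andP[/andP[_ uU'] /andP[/andP[_ vU'] _]] /andP[_ wU']] E.
have [e1 e2 e3] := prodE u (c * v * c)%g w uU wU.
have [e1' e2' e3'] := prodE u' (c * v' * c)%g w' uU' wU'.
rewrite E e1' in e1; rewrite E e2' in e2; rewrite E e3' in e3.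
have vv : v = v'.
  apply: unip_inj => //; apply: (mulfI c0); apply: (mulfI c0).
  by rewrite !ecE // in e1; apply: (lincomb1 (k := - 1) e1); ring.
rewrite -vv in e2 e3 *; have -> : u = u'.
  by apply: unip_inj => //; apply: (mulIf g0); apply/esym/(addrI _ e2).
suff -> : w = w' by [].
by apply: unip_inj => //; apply: (mulfI g0); apply/esym/(addIr _ e3).
Qed.

(** Coordinates are taken in radius 2 n and dilated sums in radius 8 n; three such factors and two
    copies of c make 24 n + 2. *)
Lemma ball_unip_cube n : (4 <= #|F|)%N -> (8 * #|F| ^ 8 <= #|(B ^+ n)%g| ^ 3)%N ->
  (#|F| ^ 3 <= 16 * #|(B ^+ (24 * n + 2))%g|)%N.
Proof.
move=> q4 big; have q0 : (0 < #|F|)%N by apply: leq_trans q4.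
pose X := unip_coord (n + n); pose L := diag_coord (n + n).
pose K := [set l ^+ 2 | l in L].
have LK : (#|L| <= 2 * #|K|)%N.
  apply: (card_fibers (f := fun l => l ^+ 2)) => [l lL | y _]; first exact: imset_f.
  apply: leq_trans (card_quadratic 0 (- y) (oner_neq0 F)); apply: subset_leq_card.
  by apply/subsetP => l; rewrite !in_set => /andP[_ /eqP ->]; apply/eqP; ring.
have := root_pieces_arith q0 (unip_coord_ge n) (diag_coord_ge n) LK big.
move=> /dilate_sum_large[_ /imsetP[l lL ->] half].
have {}half := leq_trans half (leq_mul (leqnn 2) (subset_leq_card (dilate_unip lL))).
apply: triple_arith q4 half _; apply: leq_trans (unip_triple _) _.
apply: subset_leq_card; apply: expg_sub (ball1 A) _; clear; lia.
Qed.

End Ending.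

(** A lower bound N >> q^(a/b) is kept in the integral form q^a <= c N^b. *)
Lemma exponent_step (q N M K a b c : nat) : (q ^ a <= c * N ^ b)%N ->
  (N ^ 3 * q ^ 6 <= K * M ^ 5)%N ->
  (q ^ (3 * a + 6 * b) <= c ^ 3 * K ^ b * M ^ (5 * b))%N.
Proof.
move=> h1 h2; rewrite expnD mulnC (mulnC 3) [X in (_ * X)%N]expnM.
apply: (@leq_trans (q ^ (6 * b) * (c * N ^ b) ^ 3)); first by rewrite leq_mul2l leq_exp2r ?h1 ?orbT.
rewrite expnMn mulnCA -mulnA leq_mul2l; apply/orP; right.
rewrite -expnM mulnC (mulnC b) !expnM -!expnMn; case: b {h1} => [|b] //.
by rewrite leq_exp2r.
Qed.

(** An exponent a/b above 8/3 contradicts M^3 <= 8 q^8 once q is large. *)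
Lemma exponent_end (q M a b c : nat) : (0 < q)%N -> (q ^ a <= c * M ^ b)%N -> (8 * b < 3 * a)%N ->
  (M ^ 3 <= 8 * q ^ 8)%N -> (q <= c ^ 3 * 8 ^ b)%N.
Proof.
move=> q0 h1 h2 h3; rewrite -(@leq_pmul2r (q ^ (8 * b))) ?expn_gt0 ?q0 //.
apply: (@leq_trans (q ^ (3 * a))); first by rewrite -expnS leq_pexp2l.
rewrite (mulnC 3) expnM; apply: leq_trans (_ : (c * M ^ b) ^ 3 <= _)%N; first by rewrite leq_exp2r.
rewrite expnMn -mulnA leq_mul2l; apply/orP; right.
rewrite -expnM mulnC !expnM -expnMn; case: b {h1 h2} => [|b] //.
by rewrite leq_exp2r.
Qed.

(* The exponent of q in a lower bound for a ball of size N = q^x goes up by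
   x -> (3 x + 6) / 5, so three steps lead from 2 to 348 / 125 > 8 / 3. *)
Lemma three_steps (K : nat) : exists q0, forall q N M1 M2 M3 : nat, (q0 <= q)%N ->
  (q ^ 2 <= 8 * N)%N -> (N ^ 3 * q ^ 6 <= K * M1 ^ 5)%N -> (M1 ^ 3 * q ^ 6 <= K * M2 ^ 5)%N ->
  (M2 ^ 3 * q ^ 6 <= K * M3 ^ 5)%N -> (8 * q ^ 8 <= M3 ^ 3)%N.
Proof.
pose c1 := (8 ^ 3 * K ^ 1)%N; pose c2 := (c1 ^ 3 * K ^ 5)%N; pose c3 := (c2 ^ 3 * K ^ 25)%N.
exists (c3 ^ 3 * 8 ^ 125).+1 => q N M1 M2 M3 hq h0 h1 h2 h3.
rewrite leqNgt; apply/negP => h4.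
have e1 : (q ^ 12 <= c1 * M1 ^ 5)%N by apply: (@exponent_step q N M1 K 2 1 8).
have e2 : (q ^ 66 <= c2 * M2 ^ 25)%N by apply: (exponent_step e1 h2).
have e3 : (q ^ 348 <= c3 * M3 ^ 125)%N by apply: (exponent_step e2 h3).
have q1 : (0 < q)%N by apply: leq_trans hq.
have := exponent_end q1 e3 isT (ltnW h4).
by rewrite leqNgt hq.
Qed.

Lemma above_quadratic_arith (K q N M rho : nat) : (q ^ 2 <= 8 * N)%N -> (N <= M)%N ->
  rho = (7 + (8 * M) %/ q ^ 2)%N -> (N ^ 3 <= K * (rho ^ 3 * M ^ 2))%N ->
  (N ^ 3 * q ^ 6 <= K * 64 ^ 3 * M ^ 5)%N.
Proof.
move=> hq NM hr h.
have rq : (rho * q ^ 2 <= 64 * M)%N.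
  rewrite hr mulnDl; apply: (@leq_trans (7 * (8 * M) + 8 * M)); last by rewrite -mulSnr mulnA.
  by rewrite leq_add ?leq_divM // leq_mul2l (leq_trans hq) ?leq_mul2l ?NM ?orbT.
apply: leq_trans (_ : K * (rho ^ 3 * M ^ 2) * q ^ 6 <= _)%N; first by rewrite leq_mul2r h orbT.
rewrite -(mulnA K (64 ^ 3)%N) -(mulnA K (rho ^ 3 * M ^ 2)%N) leq_mul2l; apply/orP; right.
have -> : (rho ^ 3 * M ^ 2 * q ^ 6 = (rho * q ^ 2) ^ 3 * M ^ 2)%N.
  by rewrite expnMn -expnM mulnAC.
by rewrite (expnD M 3 2) mulnA -expnMn leq_mul2r leq_exp2r ?rq ?orbT.
Qed.

Lemma torus_arith (d S q N M Q : nat) : (Q <= 2 * S)%N -> ((d + 1) * S <= 4 * q * N)%N -> (N <= M)%N ->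
  ((d + 1) * Q <= 8 * M * q)%N.
Proof.
move=> hQ hS hN; apply: (@leq_trans (2 * ((d + 1) * S))); first by rewrite mulnCA leq_mul2l hQ orbT.
apply: (@leq_trans (2 * (4 * q * M))); last by lia.
by rewrite leq_mul2l /=; apply: leq_trans hS _; rewrite leq_mul2l hN orbT.
Qed.

Section Stages.
Variable F : finFieldType.
Implicit Types u v w g x : GL2 F.
Local Notation SL := (SL2 F).
Hypothesis two0 : (2 : F) != 0.
Hypothesis three0 : (3 : F) != 0.
Variable A : {set GL2 F}.
Hypothesis genA : <<A>>%g = SL.
Hypothesis symA : (A^-1)%g = A.
Local Notation B := (1%g |: A).
Local Notation q := #|F|.

Lemma leq_ball m n : (m <= n)%N -> (#|(B ^+ m)%g| <= #|(B ^+ n)%g|)%N.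
Proof. by move=> mn; apply: subset_leq_card; apply: expg_sub (ball1 A) mn. Qed.

Lemma card_F_gt1 : (1 < q)%N.
Proof.
by rewrite (cardD1 0) (cardD1 1) !inE oner_neq0.
Qed.

Lemma SL_big : (q ^ 3 <= 2 * #|SL|)%N.
Proof.
apply: leq_trans (leq_mul (leqnn 2) (card_SL_ge F)).
rewrite mulnCA expnSr leq_mul2l; apply/orP; right.
by move: #|F| card_F_gt1 => k; clear; lia.
Qed.

(** With rho = 7 + floor (8 M / q^2) the second alternative of [ball_growth] is impossible, as it
    would give (rho - 6) q^2 <= 8 M; and rho is still at most 64 M / q^2. *)
Lemma ball_growth_above_quadratic n : (4 <= n)%N -> (q ^ 2 <= 8 * #|(B ^+ n)%g|)%N ->
  (#|(B ^+ n)%g| ^ 3 * q ^ 6 <= 48 ^ 3 * 64 ^ 3 * #|(B ^+ (8 * n + 6))%g| ^ 5)%N.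
Proof.
move=> n4 big; set M := #|(B ^+ (8 * n + 6))%g|.
have q0 : (0 < q)%N by apply: ltnW card_F_gt1.
have NM : (#|(B ^+ n)%g| <= M)%N by apply: leq_ball; lia.
have [h|] := ball_growth two0 three0 genA symA n4 (leq_addr ((8 * M) %/ q ^ 2) 7).
  exact: above_quadratic_arith big NM (erefl _) h.
rewrite (addnC 7) -addnBA //= => h.
have h2 : (#|(B ^+ (n + n))%g| <= M)%N by apply: leq_ball; lia.
have : (((8 * M) %/ q ^ 2 + 1) * q ^ 3 <= 8 * M * q)%N.
  exact: torus_arith SL_big h h2.
rewrite (expnSr q 2) mulnA leq_pmul2r // => h3; exfalso; move: h3; apply/negP.
by rewrite -ltnNge addn1 -ltn_divLR ?expn_gt0 ?q0 // ltnS leqnn.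
Qed.

End Stages.

Lemma quadratic_ball_covers : exists K q0 : nat, forall (F : finFieldType) (A : {set GL2 F}) n,
  (2 : F) != 0 -> (3 : F) != 0 -> <<A>>%g = SL2 F -> (A^-1)%g = A -> (q0 <= #|F|)%N -> (4 <= n)%N ->
  (#|SL2 F| <= 4 * #|F| * #|((1%g |: A) ^+ n)%g|)%N -> SL2 F \subset ((1%g |: A) ^+ (K * n))%g.
Proof.
have [q0 hq0] := three_steps (48 ^ 3 * 64 ^ 3).
(* The radius 24 n3 + 2 unrolled, with 6 <= 6 n and 2 <= 2 n; then 49 = 3 * 16 + 1 for a set of
   density 1/16. *)
pose K := ((24 * (8 * (8 * 14 + 6) + 6) + 2) * 49)%N.
exists K, (maxn 4 q0) => F A n two0 three0 genA symA; rewrite geq_max => /andP[q4 qq0] n4 big.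
pose n1 := (8 * n + 6)%N; pose n2 := (8 * n1 + 6)%N; pose n3 := (8 * n2 + 6)%N.
have le1 : (n <= n1)%N by rewrite /n1; lia.
have le2 : (n1 <= n2)%N by rewrite /n2; lia.
have big0 : (#|F| ^ 2 <= 8 * #|((1%g |: A) ^+ n)%g|)%N.
  have q1 : (0 < #|F|)%N by apply: leq_trans q4.
  rewrite -(leq_pmul2r q1) -expnSr; apply: leq_trans (SL_big F) _.
  by apply: leq_trans (leq_mul (leqnn 2) big) _; rewrite -!mulnA; nia.
have big1 : (#|F| ^ 2 <= 8 * #|((1%g |: A) ^+ n1)%g|)%N.
  by apply: leq_trans big0 _; rewrite leq_mul2l leq_ball.
have big2 : (#|F| ^ 2 <= 8 * #|((1%g |: A) ^+ n2)%g|)%N.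
  by apply: leq_trans big1 _; rewrite leq_mul2l leq_ball.
have s1 := ball_growth_above_quadratic two0 three0 genA symA n4 big0.
have s2 := ball_growth_above_quadratic two0 three0 genA symA (leq_trans n4 le1) big1.
have s3 := ball_growth_above_quadratic two0 three0 genA symA (leq_trans n4 (leq_trans le1 le2)) big2.
have /(ball_unip_cube genA symA q4) fin := hq0 _ _ _ _ _ qq0 big0 s1 s2 s3.
set D := ((1%g |: A) ^+ (24 * n3 + 2))%g in fin.
have D1 : 1%g \in D by apply: subsetP (expg_sub (ball1 A) (leq0n _)) _ _; rewrite expg0 set11.
have DV : (D^-1)%g = D by apply: expg_invset; apply: ballV.
have genD : <<D>>%g = SL2 F.
  apply/eqP; rewrite eqEsubset gen_subG (ball_SL genA) -genA genS //.
  apply: subset_trans (subsetUr 1%g A) _; rewrite -{1}[1%g |: A]expg1.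
  by apply: expg_sub (ball1 A) _; rewrite addn2.
have small : (#|<<D>>%g| <= 16 * #|D|)%N by rewrite genD; apply: leq_trans (card_SL_le F) fin.
have := gen_sub_expg D1 DV small; rewrite genD => c; apply: subset_trans c _.
rewrite -expgnA; apply: expg_sub (ball1 A) _.
have n0 : (0 < n)%N by apply: leq_trans n4.
rewrite /K mulnAC leq_mul2r /= /n3 /n2 /n1; clear -n0; lia.
Qed.

(** * The diameter *)

Definition radius k : nat := iter k (fun m => 8 * m + 6)%N 4%N.

Lemma radius_ge k : (4 <= radius k)%N.
Proof. by elim: k => [|k IHk] //; rewrite /radius iterS -/(radius k); lia. Qed.

Lemma radius_le k : (radius k + 1 <= 5 * 8 ^ k)%N.
Proof. by elim: k => [|k IHk] //; rewrite /radius iterS -/(radius k) expnS; lia. Qed.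

Lemma ball_growth_constant : exists2 K, (0 < K)%N & forall (F : finFieldType) (A : {set GL2 F}) m,
  (2 : F) != 0 -> (3 : F) != 0 -> <<A>>%g = SL2 F -> (A^-1)%g = A -> (4 <= m)%N ->
  (#|((1%g |: A) ^+ m)%g| ^ 3 <= K * #|((1%g |: A) ^+ (8 * m + 6))%g| ^ 2)%N \/
  (#|SL2 F| <= 4 * #|F| * #|((1%g |: A) ^+ (m + m))%g|)%N.
Proof.
exists (48 ^ 3 * 7 ^ 3)%N => [|F A m two0 three0 genA symA m4]; first by rewrite muln_gt0 !expn_gt0.
have [h|h] := ball_growth two0 three0 genA symA m4 (leqnn 7); [left|right].
  by rewrite -mulnA.
by rewrite -[X in (X <= _)%N]mul1n.
Qed.

(** * Iterating the growth step *)

Section Iteration.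
Variable R : realType.

(** N = M = K is the equality case of the hypothesis, so logarithms measured from ln K grow by the
    exact factor 3/2. *)
Lemma ln_growth (K N M : nat) : (0 < N)%N -> (0 < K)%N -> (0 < M)%N -> (N ^ 3 <= K * M ^ 2)%N ->
  3 / 2 * (ln N%:R - ln K%:R) <= ln M%:R - ln K%:R :> R.
Proof.
move=> N0 K0 M0 h.
have N0' : (0 : R) < N%:R by rewrite ltr0n.
have K0' : (0 : R) < K%:R by rewrite ltr0n.
have M0' : (0 : R) < M%:R by rewrite ltr0n.
have : ln (N%:R ^+ 3) <= ln (K%:R * M%:R ^+ 2) :> R.
  by rewrite ler_ln ?posrE ?mulr_gt0 ?exprn_gt0 // -!natrX -natrM ler_nat.
rewrite lnM ?posrE ?exprn_gt0 // !lnXn // => h'.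
rewrite -(ler_pM2l (ltr0n R 2)); move: h'; move: (ln N%:R) (ln K%:R) (ln M%:R) => x y z; lra.
Qed.

Lemma powR_8 (r : R) k : (3 / 2) ^+ k <= r -> (8 ^ k)%:R <= r `^ (ln 8 / ln (3 / 2)).
Proof.
move=> h.
have l32 : 0 < ln (3 / 2 : R) by rewrite ln_gt0 //; lra.
have l8 : 0 < ln (8 : R) by rewrite ln_gt0 //; lra.
have c0 : (0 : R) < (3 / 2) ^+ k by apply: exprn_gt0; lra.
have d0 : 0 <= ln (8 : R) / ln (3 / 2) by apply: divr_ge0; apply: ltW.
have r0 : 0 <= r by apply: le_trans (ltW c0) h.
apply: le_trans (ge0_ler_powR d0 (ltW c0 : _ \in Num.nneg) (r0 : _ \in Num.nneg) h).
rewrite /powR gt_eqF // lnXn; last by lra.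
rewrite -[X in _ * X]mulr_natr mulrA divfK ?gt_eqF // expRM_natr lnK ?posrE ?natrX //.
Qed.

Lemma exists_exp_gt (r : R) : exists k, r < (3 / 2) ^+ k.
Proof.
have bern k : 1 + k%:R / 2 <= (3 / 2 : R) ^+ k.
  elim: k => [|k IHk]; first by rewrite expr0 mul0r addr0.
  have h32 : 0 <= 3 / 2 :> R by lra.
  rewrite exprS; apply: le_trans (ler_wpM2l h32 IHk).
  by rewrite -natr1; have := ler0n R k; move: (k%:R) => x; lra.
exists (Num.bound `|2 * r|); apply: lt_le_trans (bern _).
have := archi_boundP (normr_ge0 (2 * r)); have := ler_norm (2 * r).
move: `|2 * r| ((Num.bound _)%:R) => x y; lra.
Qed.

Variable F : finFieldType.
Variable A : {set GL2 F}.
Hypothesis genA : <<A>>%g = SL2 F.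
Hypothesis symA : (A^-1)%g = A.
Local Notation B := (1%g |: A).
Local Notation f k := #|(B ^+ radius k)%g|.

Variable K0 : nat.
Hypothesis K0pos : (0 < K0)%N.
Hypothesis growth_step : forall m, (4 <= m)%N ->
  (#|(B ^+ m)%g| ^ 3 <= K0 * #|(B ^+ (8 * m + 6))%g| ^ 2)%N \/
  (#|SL2 F| <= 4 * #|F| * #|(B ^+ (m + m))%g|)%N.

Definition quadratic_radius k := (#|SL2 F| <= 4 * #|F| * #|(B ^+ (radius k + radius k))%g|)%N.

Lemma ball_gt0 m : (0 < #|(B ^+ m)%g|)%N.
Proof.
apply/card_gt0P; exists 1%g; apply: subsetP (expg_sub (ball1 A) (leq0n _)) _ _.
by rewrite expg0 set11.
Qed.

Lemma ln_ball k : (forall j, (j < k)%N -> ~~ quadratic_radius j) ->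
  (3 / 2) ^+ k * (ln #|A|%:R - ln K0%:R) <= ln (f k)%:R - ln K0%:R :> R.
Proof.
elim: k => [|k IHk] small.
  rewrite expr0 mul1r lerD2r.
  (* For empty A, [ln] has its default value 0 at 0. *)
  have [->|A0] := posnP #|A|; first by rewrite ln0 // ln_ge0 // ler1n ball_gt0.
  rewrite ler_ln ?posrE ?ltr0n ?ball_gt0 // ler_nat; apply: subset_leq_card.
  apply: subset_trans (subsetUr 1%g A) _; rewrite -{1}[B]expg1.
  by apply: expg_sub (ball1 A) _.
have {}IHk := IHk (fun j jk => small j (ltnW jk)).
have [h|h] := growth_step (radius_ge k); last first.
  by have := small k (ltnSn k); rewrite /quadratic_radius h.
apply: le_trans (ln_growth (ball_gt0 _) K0pos (ball_gt0 _) h).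
by rewrite exprS -mulrA; apply: ler_wpM2l => //; lra.
Qed.

Lemma diameter_bound (K : nat) :
  (forall n, (4 <= n)%N -> (#|SL2 F| <= 4 * #|F| * #|(B ^+ n)%g|)%N -> SL2 F \subset (B ^+ (K * n))%g) ->
  forall C : R, K0%:R <= C -> C < #|A|%:R ->
  exists2 m, SL2 F \subset (B ^+ m)%g & 
    m%:R <= (10 * K)%:R * (ln #|SL2 F|%:R / ln (#|A|%:R / C)) `^ (ln 8 / ln (3 / 2)).
Proof.
move=> final C KC CA.
have K0R : (1 : R) <= K0%:R by rewrite ler1n.
have C0 : 0 < C by apply: lt_le_trans KC; apply: lt_le_trans K0R.
have AR : (0 : R) < #|A|%:R by apply: lt_trans CA.
have lpos : 0 < ln (#|A|%:R / C) by rewrite ln_gt0 // ltr_pdivlMr // mul1r.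
set r := ln #|SL2 F|%:R / ln (#|A|%:R / C).
have rk k : (forall j, (j < k)%N -> ~~ quadratic_radius j) -> (3 / 2) ^+ k <= r.
  move=> /ln_ball h; rewrite /r ler_pdivlMr //.
  have e0 : (0 : R) <= (3 / 2) ^+ k by apply: exprn_ge0; lra.
  apply: (@le_trans _ _ ((3 / 2) ^+ k * (ln #|A|%:R - ln K0%:R))).
    apply: ler_wpM2l => //; rewrite lnM ?posrE ?invr_gt0 // lnV ?posrE //.
    by rewrite lerD2l lerN2 ler_ln ?posrE ?ltr0n.
  apply: le_trans h _; rewrite lerBlDr; apply: (@le_trans _ _ (ln #|SL2 F|%:R)).
    rewrite ler_ln ?posrE ?ltr0n ?ball_gt0 ?cardG_gt0 // ler_nat.
    exact: subset_leq_card (ball_SL genA _).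
  by rewrite lerDl ln_ge0.
have ex : exists k, quadratic_radius k.
  have [k hk] := exists_exp_gt r.
  have [/existsP[j jl]|/existsPn none] := boolP [exists j : 'I_k, quadratic_radius j]; first by exists j.
  by have := rk k (fun j jk => none (Ordinal jk)); rewrite leNgt hk.
have [k kl kmin] := ex_minnP ex.
exists (K * (radius k + radius k))%N; first by apply: final => //; apply: leq_trans (radius_ge k) (leq_addr _ _).
(* k is the least quadratic radius index, so (3/2)^k <= r holds at k itself; and 2 * [radius k] <=
   10 * 8^k. *)
have h8 : (8 ^ k)%:R <= r `^ (ln 8 / ln (3 / 2)).
  by apply: powR_8; apply: rk => j; apply: contraTN => /kmin; rewrite leqNgt.
apply: le_trans (ler_wpM2l (ler0n _ _) h8); rewrite -natrM ler_nat.
rewrite -mulnA mulnCA leq_mul2l; apply/orP; right.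
by have := radius_le k; move: (8 ^ k)%N (radius k) => x y; clear; lia.
Qed.

End Iteration.

Lemma expg_word_ball (gT : finGroupType) (A : {set gT}) m : ((1%g |: A) ^+ m \subset word_ball A m)%g.
Proof.
elim: m => [|m IHm]; apply/subsetP => x.
  by rewrite expg0 => xe; apply/bigcupP; exists ord0; rewrite ?expg0.
rewrite expgSr => /mulsgP[y b /(subsetP IHm)/bigcupP[k _ yk] + ->].
case/setU1P => [->|bA].
  by rewrite mulg1; apply/bigcupP; exists (widen_ord (leqnSn _) k).
by apply/bigcupP; exists (lift ord0 k) => //; rewrite lift0 expgSr mem_mulg.
Qed.

Lemma exists_diameter (gT : finGroupType) (G A : {set gT}) n : G \subset word_ball A n ->
  exists2 m, is_cayley_diameter G A m & (m <= n)%N.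
Proof.
move=> Gn; have ex : exists m, G \subset word_ball A m by exists n.
by have [m Gm mmin] := ex_minnP ex; exists m; [split | exact: mmin].
Qed.

Theorem corollary1 (R : realType) :
  exists C : R, 1 < C /\
    forall (p : nat) (A : {set {'GL_2(p)}}),
      prime p ->
      symmetric_set A ->
      <<A>>%g = 'SL_2(p)%g ->
      C < #|A|%:R ->
      exists m : nat,
        is_cayley_diameter 'SL_2(p)%g A m /\
        m%:R <= C * (ln (#|'SL_2(p)%g|%:R) / ln (#|A|%:R / C))
                      `^ (ln 8 / ln (3 / 2)).
Proof.
have [K [q0 final]] := quadratic_ball_covers; have [K0 K0pos step] := ball_growth_constant.
(* K0 is the base of the logarithms, 10 K the factor in [diameter_bound], and 2 gives C > 1. The
   cube excludes p below q0 or 5, since then A has at most p^3 elements; p >= 5 makes 2 and 3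
   invertible. *)
pose C := (K0 + 10 * K + maxn q0 5 ^ 3 + 2)%N.
exists C%:R; split; first by rewrite ltr1n /C addn2.
move=> p A pr symA genA CA.
have cF : #|'F_p| = p by rewrite card_Fp.
have genA' : <<A : {set GL2 'F_p}>>%g = SL2 'F_p by [].
have symA' : ((A : {set GL2 'F_p})^-1)%g = A by rewrite [RHS]symA.
have pbig : (maxn q0 5 <= p)%N.
  rewrite leqNgt; apply/negP => pq; move: CA; apply/negP; rewrite -leNgt ler_nat.
  apply: (@leq_trans (p ^ 3)).
    rewrite -[in leqRHS]cF; apply: leq_trans (card_SL_le 'F_p).
    by apply: subset_leq_card; rewrite -genA' subset_gen.
  apply: (@leq_trans (maxn q0 5 ^ 3)); first by rewrite leq_exp2r // ltnW.
  by rewrite /C -addnA addnCA leq_addr.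
move: pbig; rewrite geq_max => /andP[pq0 p5].
have unit_nat n : (0 < n < p)%N -> (n%:R : 'F_p) != 0.
  move=> /andP[n0 np]; rewrite -(dvdn_pcharf (pchar_Fp pr)); apply/negP => /dvdn_leq.
  by move=> /(_ n0); rewrite leqNgt np.
have two0 : (2 : 'F_p) != 0 by apply: unit_nat; rewrite (leq_trans _ p5).
have three0 : (3 : 'F_p) != 0 by apply: unit_nat; rewrite (leq_trans _ p5).
have q0F : (q0 <= #|'F_p|)%N by rewrite cF.
have fin n n4 := final 'F_p A n two0 three0 genA' symA' q0F n4.
have stp m m4 := step 'F_p A m two0 three0 genA' symA' m4.
have KC : K0%:R <= C%:R :> R by rewrite ler_nat /C -!addnA leq_addr.
have [n sub bound] := diameter_bound genA' K0pos stp fin KC CA.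
have [m mdiam mn] := exists_diameter (subset_trans sub (expg_word_ball A n)).
exists m; split; first exact: mdiam.
apply: (@le_trans _ _ n%:R); first by rewrite ler_nat.
apply: le_trans bound _; apply: ler_wpM2r; first exact: powR_ge0.
by rewrite ler_nat /C; move: (10 * K)%N (maxn q0 5 ^ 3)%N => x y; clear; lia.
Qed.
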